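(* There exist a constant $\epsilon\in(0,1]$ and an infinite family of finite bipartite graphs (with arbitrarily many vertices) of maximum degree $3$, each of which is a bipartite $\epsilon$-expander and has a $2$-queue layout.
   Context: For $\epsilon\in(0,1]$, a bipartite graph $G$ with bipartition $V(G)=A\cup B$ is a bipartite $\epsilon$-expander if $|A|=|B|$ and $|N(S)|\geq(1+\epsilon)|S|$ for every subset $S\subset A$ with $|S|\leq |A|/2$, where $N(S)$ is the set of vertices adjacent to some vertex of $S$. A $k$-queue layout of a graph $G$ consists of a linear order $(u_1,\dots,u_n)$ of $V(G)$ and a partition $E_1,\dots,E_k$ of $E(G)$ such that for each $i$ there are no edges $u_au_b,u_cu_d\in E_i$ with $a<c<d<b$ (no two edges in the same part nest). *)

(* Defs.v *)
From HB Require Import structures.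
From mathcomp Require Import all_boot all_order all_algebra.
From mathcomp Require Import reals.
Set Implicit Arguments. Unset Strict Implicit. Unset Printing Implicit Defensive.
Import Order.TTheory GRing.Theory Num.Theory.

Definition simple_graph (T : finType) (e : rel T) : Prop :=
  (forall x y, e x y = e y x) /\ (forall x, ~~ e x x).

Definition nbhd (T : finType) (e : rel T) (x : T) : {set T} := [set y | e x y].

Definition max_degree (T : finType) (e : rel T) (d : nat) : Prop :=
  (forall x, #|nbhd e x| <= d)%N /\ (exists x, #|nbhd e x| = d).

Definition neighbourhood (T : finType) (e : rel T) (S : {set T}) : {set T} :=
  [set y | [exists x in S, e x y]].

Definition bipartition (T : finType) (e : rel T) (A B : {set T}) : Prop :=
  [disjoint A & B] /\ A :|: B = [set: T] /\
  (forall x y, e x y -> (x \in A) && (y \in B) || (x \in B) && (y \in A)).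

Definition bip_expander (R : realType) (eps : R) (T : finType) (e : rel T)
    (A B : {set T}) : Prop :=
  bipartition e A B /\ #|A| = #|B| /\
  (forall S : {set T}, S \subset A -> (2 * #|S| <= #|A|)%N ->
     ((1 + eps) * (#|S|%:R) <= (#|neighbourhood e S|%:R))%R).

(* k-queue layout: a linear order given by an injective position map pos,
   and a partition of the edges into k classes given by col (well defined on
   unordered edges); no two edges of the same class nest. *)
Definition queue_layout (k : nat) (T : finType) (e : rel T)
    (pos : T -> nat) (col : T -> T -> 'I_k) : Prop :=
  injective pos /\
  (forall x y, e x y -> col x y = col y x) /\
  (forall a b c d, e a b -> e c d -> col a b = col c d ->
     ~ [/\ (pos a < pos c)%N, (pos c < pos d)%N & (pos d < pos b)%N]).

Definition has_queue_layout (k : nat) (T : finType) (e : rel T) : Prop :=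
  exists pos col, @queue_layout k T e pos col.

(* Main.v *)
Require Import Defs.
From HB Require Import structures.
From mathcomp Require Import all_boot all_order all_algebra.
From mathcomp Require Import reals complex.
From mathcomp Require Import ring lra zify.
Set Implicit Arguments. Unset Strict Implicit. Unset Printing Implicit Defensive.
Import Order.TTheory GRing.Theory Num.Theory.

(* The graphs come from constantly many partial monotone injections of a
   finite linear order which together expand every set of density between 1/4
   and 3/4.

   The ground set is [X = Z * U].  The core [Z = (Z/2^n)^2] carries the shears
   [(a + 4 b, b)], [(a, b + 4 a)] and the two unit translations; on the dual
   group the shears play ping-pong with the sizes [|1 - w^x|], which gives an
   absolute spectral gap.  These maps are not monotone, but each changes bit [k]
   in a way depending only on the bits below [k].  List the bits of [a] and [b]
   alternately from the lowest and glue to bit [w_k] a cyclic digit [u_k] with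
   about [2 ^ k] values, so that [2 u_k + w_k] is the [k]-th digit of the rank of
   a point, the digit 0 being the most significant.  A change of a bit then
   becomes the addition of 0 or 1 to a digit, by an amount depending only on
   the more significant digits: a monotone map off the rare points where a
   digit wraps around.  Two further families of maps translate the digits by
   functions of the bits of the core.  Expand a function on [X] in characters
   of [U]: translations by small amounts kill the characters with a high
   component, the compensations of the core maps hardly move the other
   characters, so the spectral gap of the core makes their coefficients almost
   constant, and translations by multiples of [2 ^ (i - 1)], whose overflow is
   carried to the next more significant digit, kill what remains except the
   trivial character.

   Deleting a maximal small set with few exits leaves a set [Y] on which all
   sets of density at most 2/3 expand.  Copies of [Y] are arranged as the
   layers of a cycle of even length, consecutive layers being matched by the
   identity, and each partial map joins one further pair of consecutive layers;
   the maximum degree is 3.  A set in the even layers with few neighbours has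
   nearly equal traces on all of them, hence its smallest trace contradicts
   the expansion of [Y].  Fold the cycle in two and order the vertices by
   column, then by rank: the identity edges between different columns have all
   the same length, so they do not nest, and neither do the edges of monotone
   maps in disjoint pairs of columns. *)

(** * Complex moduli and Fourier analysis on finite abelian groups *)

Section SquaredModulus.
Local Open Scope ring_scope.
Local Open Scope complex_scope.
Variable R : rcfType.
Implicit Types x y z t : R[i].
Local Notation Re := complex.Re.
Local Notation Im := complex.Im.

(** Real-valued, unlike the norm of [R[i]], so that it can be compared within the ordered field
    [R]. *)
Definition nsq x : R := Re x ^+ 2 + Im x ^+ 2.

Lemma nsq_ge0 x : 0 <= nsq x.
Proof. by rewrite addr_ge0 ?sqr_ge0. Qed.

Lemma nsq0 : nsq 0 = 0.
Proof. by rewrite /nsq /= expr0n /= addr0. Qed.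

Lemma nsq1 : nsq 1 = 1.
Proof. by rewrite /nsq /= expr0n /= addr0 expr1n. Qed.

Lemma nsqM x y : nsq (x * y) = nsq x * nsq y.
Proof. by case: x => a b; case: y => c d; rewrite /nsq /=; ring. Qed.

Lemma nsqC x y : nsq (x - y) = nsq (y - x).
Proof. by case: x => a b; case: y => c d; rewrite /nsq /=; ring. Qed.

Lemma nsqN x : nsq (- x) = nsq x.
Proof. by case: x => a b; rewrite /nsq /=; ring. Qed.

Lemma nsqR (a : R) : nsq a%:C = a ^+ 2.
Proof. by rewrite /nsq /= expr0n /= addr0. Qed.

Lemma nsqX x n : nsq (x ^+ n) = nsq x ^+ n.
Proof. by elim: n => [|n IH]; rewrite ?expr0 ?nsq1 // !exprS nsqM IH. Qed.

Lemma nsq_eq0 x : (nsq x == 0) = (x == 0).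
Proof.
case: x => a b; rewrite /nsq /= paddr_eq0 ?sqr_ge0 // !sqrf_eq0.
by rewrite eq_complex.
Qed.

Lemma mulcJ_nsq x : x * conjc x = (nsq x)%:C.
Proof.
by case: x => a b; rewrite /nsq /=; simpc; congr (_ +i* _); ring.
Qed.

Lemma nsqD_le x y : nsq (x + y) <= 2%:R * nsq x + 2%:R * nsq y.
Proof.
case: x => a b; case: y => c d; rewrite /nsq /=.
by have := sqr_ge0 (a - c); have := sqr_ge0 (b - d); lra.
Qed.

(** Young's inequality weighted to keep the factor of [nsq y] near 1. In the ping-pong estimate two
    images of a cone then count with weight 4/5 each, and [1 + 4/5 + 4/5 > 2] leaves room for two
    cones. *)
Lemma nsqB_le_strong x y : nsq x <= (5%:R / 4%:R) * nsq y + 5%:R * nsq (x - y).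
Proof.
case: x => a b; case: y => c d; rewrite /nsq /=.
have := sqr_ge0 (4%:R * a - 5%:R * c).
by have := sqr_ge0 (4%:R * b - 5%:R * d); lra.
Qed.

Lemma nsqD4_le x y z t :
  nsq (x + y + z + t) <= 4%:R * (nsq x + nsq y + nsq z + nsq t).
Proof.
case: x => a b; case: y => c d; case: z => e f; case: t => g h.
rewrite /nsq /=.
have Q (p q r s : R) : (p + q + r + s) ^+ 2 <=
    4%:R * (p ^+ 2 + q ^+ 2 + r ^+ 2 + s ^+ 2).
  have := sqr_ge0 (p - q); have := sqr_ge0 (p - r); have := sqr_ge0 (p - s).
  have := sqr_ge0 (q - r); have := sqr_ge0 (q - s); have := sqr_ge0 (r - s).
  lra.
by have := Q a c e g; have := Q b d f h; lra.
Qed.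

Lemma nsq1B x : nsq x = 1 -> nsq (x - 1) = 2%:R - 2%:R * Re x.
Proof. case: x => a b; rewrite /nsq /= => H; nra. Qed.

Lemma nsq1D x : nsq x = 1 -> nsq (1 + x) = 2%:R + 2%:R * Re x.
Proof. case: x => a b; rewrite /nsq /= => H; nra. Qed.

Lemma Re_sqr_le x : Re x ^+ 2 <= nsq x.
Proof. by case: x => a b; rewrite /nsq /=; nra. Qed.

Definition cnorm x : R := Num.sqrt (nsq x).

Lemma cnorm_ge0 x : 0 <= cnorm x. Proof. exact: sqrtr_ge0. Qed.

Lemma cnorm_sqr x : cnorm x ^+ 2 = nsq x.
Proof. by rewrite sqr_sqrtr ?nsq_ge0. Qed.

Lemma cnormM x y : cnorm (x * y) = cnorm x * cnorm y.
Proof. by rewrite /cnorm nsqM sqrtrM ?nsq_ge0. Qed.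

Lemma cnorm0 : cnorm 0 = 0. Proof. by rewrite /cnorm nsq0 sqrtr0. Qed.

Lemma cnorm1 : cnorm 1 = 1. Proof. by rewrite /cnorm nsq1 sqrtr1. Qed.

Lemma cnorm_eq0 x : (cnorm x == 0) = (x == 0).
Proof. by rewrite -nsq_eq0 -cnorm_sqr sqrf_eq0. Qed.

Lemma cnormN x : cnorm (- x) = cnorm x. Proof. by rewrite /cnorm nsqN. Qed.

Lemma cnormC x y : cnorm (x - y) = cnorm (y - x).
Proof. by rewrite /cnorm nsqC. Qed.

Lemma cnormD x y : cnorm (x + y) <= cnorm x + cnorm y.
Proof.
have cE z : cnorm z = ComplexField.Normc.normc z by case: z.
by rewrite !cE; apply: le_normcD.
Qed.

Lemma cnormB x y : cnorm x - cnorm y <= cnorm (x - y).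
Proof. by rewrite lerBlDr -[in leLHS](subrK y x) cnormD. Qed.

Lemma cnorm_sqrB_le x y : (cnorm x - cnorm y) ^+ 2 <= nsq (x - y).
Proof.
rewrite -cnorm_sqr; have h1 := cnormB x y.
have h2 : cnorm y - cnorm x <= cnorm (x - y) by rewrite cnormC cnormB.
have := cnorm_ge0 (x - y); nra.
Qed.

Lemma cnorm_sum (I : Type) (r : seq I) (P : pred I) (F : I -> R[i]) :
  cnorm (\sum_(i <- r | P i) F i) <= \sum_(i <- r | P i) cnorm (F i).
Proof.
elim/big_rec2: _ => [|i y x _ IH]; first by rewrite cnorm0.
by apply: le_trans (cnormD _ _) _; rewrite lerD2l.
Qed.

Lemma cnormX x n : cnorm (x ^+ n) = cnorm x ^+ n.
Proof. by elim: n => [|n IH]; rewrite ?expr0 ?cnorm1 // !exprS cnormM IH. Qed.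

Lemma cnormR (a : R) : cnorm a%:C = `|a|.
Proof. by rewrite /cnorm nsqR sqrtr_sqr. Qed.

Lemma cnorm_nat n : cnorm n%:R = n%:R.
Proof. by rewrite -(rmorph_nat (real_complex R)) cnormR normr_nat. Qed.

Lemma cnorm_subX1 x n : cnorm x = 1 -> cnorm (x ^+ n - 1) <= n%:R * cnorm (x - 1).
Proof.
move=> x1; elim: n => [|n IH]; first by rewrite expr0 subrr cnorm0 mul0r.
have -> : x ^+ n.+1 - 1 = x * (x ^+ n - 1) + (x - 1) by rewrite exprS; ring.
apply: le_trans (cnormD _ _) _; rewrite cnormM x1 mul1r -natr1 mulrDl mul1r.
by rewrite lerD2r.
Qed.

Lemma cnorm_prodB1 (I : Type) (r : seq I) (F : I -> R[i]) :
  (forall i, cnorm (F i) = 1) ->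
  cnorm (\prod_(i <- r) F i - 1) <= \sum_(i <- r) cnorm (F i - 1).
Proof.
move=> F1; elim: r => [|i r IH]; first by rewrite !big_nil subrr cnorm0.
rewrite !big_cons; set p := \prod_(j <- r) _ in IH *.
have -> : F i * p - 1 = F i * (p - 1) + (F i - 1) by ring.
apply: le_trans (cnormD _ _) _.
by rewrite cnormM F1 mul1r addrC lerD2l.
Qed.

(* Summing the powers of a root of unity [x <> 1] gives 0, so their distances
   to 1 sum to [m], while each is at most [i * |x - 1|]. *)
Lemma unity_root_dist (x : R[i]) (m : nat) : (0 < m)%N ->
  cnorm x = 1 -> x ^+ m = 1 -> x != 1 -> 2%:R <= m%:R * cnorm (x - 1).
Proof.
move=> m0 x1 xm xn1.
have sum0 : \sum_(i < m) x ^+ i = 0.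
  apply: (mulfI (x := x - 1)); first by rewrite subr_eq0.
  by rewrite mulr0 -subrX1 xm subrr.
have m2 : (1 < m)%N.
  case: m m0 xm sum0 => [//|[|//]] _ xm.
  by move: xn1; rewrite -[x]expr1 xm eqxx.
have le_m : m%:R <= \sum_(i < m) (i%:R * cnorm (x - 1)).
  have -> : m%:R = cnorm (\sum_(i < m) (x ^+ i - 1)) :> R.
    by rewrite sumrB sum0 sumr_const card_ord sub0r cnormN -[1 *+ m]/(m%:R) cnorm_nat.
  apply: le_trans (cnorm_sum _ _ _) _; apply: ler_sum => i _; exact: cnorm_subX1.
move: le_m; rewrite -mulr_suml -natr_sum.
have -> : (\sum_(i < m) i)%N = 'C(m, 2) by rewrite -bin2_sum big_mkord.
have e2 : 2%:R * ('C(m, 2))%:R = m%:R * (m%:R - 1) :> R.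
  rewrite -natrM mul2n bin2 halfK oddM.
  case: m m0 {xm sum0 m2} => // m _; rewrite /= andNb subn0 natrM.
  by rewrite -natr1; ring.
move=> h; have := cnorm_ge0 (x - 1); have : 1 < m%:R :> R by rewrite ltr1n.
nra.
Qed.

End SquaredModulus.

(** * Characters, the Fourier transform and Parseval's identity *)

Section Fourier.
Local Open Scope ring_scope.
Local Open Scope complex_scope.
Variables (R : rcfType) (U : finZmodType) (e : U -> U -> R[i]).

(** A symmetric nondegenerate bicharacter; it identifies [U] with its dual group, so that characters
    are indexed by [U] itself. *)
Definition pairing : Prop :=
  [/\ forall x y z, e x (y + z) = e x y * e x z,
      forall x y, e x y = e y x,
      forall x y, cnorm (e x y) = 1
    & forall x, x != 0 -> exists y, e x y != 1].

Hypothesis he : pairing.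

Lemma pairDr x y z : e x (y + z) = e x y * e x z. Proof. by case: he. Qed.
Lemma pairC x y : e x y = e y x. Proof. by case: he. Qed.
Lemma cnorm_pair x y : cnorm (e x y) = 1. Proof. by case: he. Qed.
Lemma nsq_pair x y : nsq (e x y) = 1.
Proof. by rewrite -cnorm_sqr cnorm_pair expr1n. Qed.
Lemma pair_nz x : x != 0 -> exists y, e x y != 1. Proof. by case: he => _ _ _; apply. Qed.
Lemma pairJ x y : e x y * conjc (e x y) = 1.
Proof. by rewrite mulcJ_nsq nsq_pair. Qed.
Lemma pair_neq0 x y : e x y != 0.
Proof. by rewrite -nsq_eq0 nsq_pair oner_eq0. Qed.
Lemma pairr0 x : e x 0 = 1.
Proof. by apply: (mulfI (pair_neq0 x 0)); rewrite -pairDr addr0 mulr1. Qed.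
Lemma pair0r x : e 0 x = 1. Proof. by rewrite pairC pairr0. Qed.
Lemma pairDl x y z : e (x + y) z = e x z * e y z.
Proof. by rewrite !(pairC _ z) pairDr. Qed.
Lemma pairNr x y : e x (- y) = conjc (e x y).
Proof.
by apply: (mulfI (pair_neq0 x y)); rewrite -pairDr subrr pairr0 pairJ.
Qed.
Lemma pairMn x y n : e x (y *+ n) = e x y ^+ n.
Proof. by elim: n => [|n IH]; rewrite ?mulr0n ?pairr0 ?expr0 // mulrS exprS pairDr IH. Qed.
Lemma pairMnl x y n : e (x *+ n) y = e x y ^+ n.
Proof. by rewrite pairC pairMn pairC. Qed.

Lemma sum_pair x : \sum_u e x u = if x == 0 then #|U|%:R else 0.
Proof.
have [->|/pair_nz[y hy]] := eqVneq x 0.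
  under eq_bigr do rewrite pair0r.
  by rewrite sumr_const.
apply: (mulfI (x := e x y - 1)); first by rewrite subr_eq0.
rewrite mulr0 mulrBl mul1r [X in _ - X](reindex_inj (addrI y)) /=.
by under [X in _ - X]eq_bigr do rewrite pairDr; rewrite mulr_sumr subrr.
Qed.

Lemma pair_orthogonal u v :
  \sum_l e l u * conjc (e l v) = if u == v then #|U|%:R else 0.
Proof.
under eq_bigr do rewrite -pairNr -pairDr pairC.
by rewrite sum_pair subr_eq0.
Qed.

Definition fourier (f : U -> R[i]) (l : U) := \sum_u f u * conjc (e l u).

Lemma parseval f : \sum_l nsq (fourier f l) = #|U|%:R * \sum_u nsq (f u).
Proof.
apply: (@complexI R); rewrite rmorphM /= !rmorph_sum /= rmorph_nat.
pose F u v l := f u * conjc (f v) * (e l v * conjc (e l u)).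
transitivity (\sum_l \sum_u \sum_v F u v l).
  apply: eq_bigr => l _; rewrite -mulcJ_nsq /fourier rmorph_sum /= mulr_suml.
  apply: eq_bigr => u _; rewrite mulr_sumr; apply: eq_bigr => v _.
  by rewrite rmorphM /= conjcK /F mulrACA [conjc _ * _]mulrC.
rewrite exchange_big /= mulr_sumr; apply: eq_bigr => u _.
rewrite exchange_big /= (bigD1 u) //= [X in _ + X]big1 ?addr0 => [|v vu].
  by rewrite -mulcJ_nsq -mulr_sumr pair_orthogonal eqxx mulrC.
by rewrite -mulr_sumr pair_orthogonal (negPf vu) mulr0.
Qed.

Lemma fourier_shift f a l :
  fourier (fun u => f (u + a)) l = e l a * fourier f l.
Proof.
rewrite /fourier [in RHS](reindex_inj (addIr a)) mulr_sumr /=.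
by apply: eq_bigr => u _; rewrite pairDr rmorphM mulrCA [e l a * _]mulrCA pairJ mulr1.
Qed.

Lemma fourierB f g l : fourier (fun u => f u - g u) l = fourier f l - fourier g l.
Proof. by rewrite /fourier -sumrB; apply: eq_bigr => u _; rewrite mulrBl. Qed.

Definition synthesis (c : U -> R[i]) (u : U) := #|U|%:R^-1 * \sum_l c l * e l u.

Lemma card_neq0 : #|U|%:R != 0 :> R[i].
Proof. by rewrite pnatr_eq0 -lt0n; apply/card_gt0P; exists 0. Qed.

Lemma fourier_synthesis c l : fourier (synthesis c) l = c l.
Proof.
rewrite /fourier /synthesis.
under eq_bigr => u _ do rewrite -mulrA mulr_suml.
rewrite -mulr_sumr exchange_big /= (bigD1 l) //= [X in _ + X]big1 ?addr0.
  under eq_bigr => u _ do rewrite -mulrA pairJ mulr1.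
  rewrite sumr_const -[c l *+ _]mulr_natl mulrA mulVf ?mul1r //.
  exact: card_neq0.
move=> k kl; under eq_bigr => u _ do rewrite -mulrA ![e _ u]pairC.
by rewrite -mulr_sumr pair_orthogonal (negPf kl) mulr0.
Qed.

End Fourier.

(** * Spectral gap of skew products *)

Section Mean.
Local Open Scope ring_scope.
Local Open Scope complex_scope.
Variables (R : rcfType) (Z : finType).

Definition cmean (g : Z -> R[i]) : R[i] := #|Z|%:R^-1 * \sum_z g z.

(** A Poincaré inequality; functions are complex because it is applied to Fourier coefficients taken
    along the fibres. *)
Definition spectral_gap (J : finType) (sigma : J -> Z -> Z) (gam : R) : Prop :=
  forall g : Z -> R[i],
    gam * \sum_z nsq (g z - cmean g) <= \sum_j \sum_z nsq (g (sigma j z) - g z).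

Lemma Re_le_cnorm (x : R[i]) : complex.Re x <= cnorm x.
Proof.
have := Re_sqr_le x; rewrite -cnorm_sqr => h.
by have := cnorm_ge0 x; nra.
Qed.

Lemma Re_sum (I : Type) (r : seq I) (P : pred I) (F : I -> R[i]) :
  complex.Re (\sum_(i <- r | P i) F i) = \sum_(i <- r | P i) complex.Re (F i).
Proof. by apply: (big_morph (@complex.Re R)) => // -[? ?] [? ?]. Qed.

(** Turns cancellation in a sum of numbers of modulus 1 into a lower bound for their total squared
    distance to 1. *)
Lemma sum_nsqB1 (x : Z -> R[i]) : (forall z, cnorm (x z) = 1) ->
  2%:R * #|Z|%:R - 2%:R * cnorm (\sum_z x z) <= \sum_z nsq (x z - 1).
Proof.
move=> x1; rewrite [leRHS](eq_bigr (fun z => 2%:R - 2%:R * complex.Re (x z))); last first.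
  by move=> z _; rewrite nsq1B // -cnorm_sqr x1 expr1n.
rewrite sumrB sumr_const -mulr_sumr -Re_sum -[2%:R *+ _]mulr_natr.
by have := Re_le_cnorm (\sum_z x z); lra.
Qed.

End Mean.

Section SkewGap.
Local Open Scope ring_scope.
Local Open Scope complex_scope.
Variables (R : rcfType) (U : finZmodType) (e : U -> U -> R[i]).
Hypothesis he : pairing e.
Variables (Z J : finType) (sigma : J -> Z -> Z) (gam rho2 : R).
Hypotheses (gam_gt0 : 0 < gam) (gam_le1 : gam <= 1).
Hypothesis sigma_inj : forall j, injective (sigma j).
Hypothesis hgap : spectral_gap sigma gam.
(** [bit_drop] is the fibre part of the core maps, [a] and [h] are fibre translations depending on
    the core point, and [F p] acts nearly as the translation by [h p] on functions with spectrum in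
    [L]. Of the two values of [p], each character needs only one to be effective. *)
Variables (bit_drop : J -> Z -> U) (a h : bool -> Z -> U) (L : pred U).
Variable F : bool -> Z * U -> Z * U.
Hypothesis F_inj : forall p, injective (F p).
Hypothesis high_kill : forall l, ~~ L l ->
  exists p, cnorm (\sum_z e l (a p z)) <= (7%:R / 8%:R) * #|Z|%:R.
Hypothesis low_flat : forall l j z, L l -> nsq (e l (bit_drop j z) - 1) <= rho2.
Hypothesis low_kill : forall l, L l -> l != 0 ->
  exists p, cnorm (\sum_z e l (h p z)) <= (3%:R / 4%:R) * #|Z|%:R.
Hypothesis low_carry : forall p (G : U -> R[i]),
  (forall l, ~~ L l -> fourier e G l = 0) ->
  \sum_x nsq (G (F p x).2 - G (x.2 + h p x.1)) <= rho2 * #|Z|%:R * \sum_u nsq (G u).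
Hypothesis rho2_ge0 : 0 <= rho2.
Hypothesis rho2_small : rho2 <= 1 / 32%:R.
Hypothesis rho2_gam : 520%:R * #|J|%:R * rho2 <= gam.

Let NU_gt0 : 0 < #|U|%:R :> R.
Proof. by rewrite ltr0n; apply/card_gt0P; exists 0. Qed.

Variable f : Z -> U -> R[i].
Hypothesis f0 : \sum_z \sum_u f z u = 0.

(** The transform is taken along the fibres only, so [g l] is a function on the core. Up to the
    factor [#|U|], [w l], [v p l] and [s l] are the parts at the character [l] of the energies of
    the core maps and of the translations by [a], and of the norm of [f]. *)
Let g l z := fourier e (f z) l.
Let r l z := cnorm (g l z).
Let m l := #|Z|%:R^-1 * \sum_z r l z.
Let Var l := \sum_z (r l z - m l) ^+ 2.
Let w l := \sum_j \sum_z nsq (e l (bit_drop j z) * g l (sigma j z) - g l z).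
Let v p l := \sum_z nsq (e l (a p z) * g l z - g l z).
Let s l := \sum_z nsq (g l z).
Let c l := cmean (g l).
Let t l := \sum_z nsq (g l z - c l).

Let s_ge0 l : 0 <= s l. Proof. by apply: sumr_ge0 => z _; apply: nsq_ge0. Qed.
Let Var_ge0 l : 0 <= Var l. Proof. by apply: sumr_ge0 => z _; apply: sqr_ge0. Qed.
Let v_ge0 p l : 0 <= v p l. Proof. by apply: sumr_ge0 => z _; apply: nsq_ge0. Qed.
Let w_ge0 l : 0 <= w l.
Proof. by apply: sumr_ge0 => j _; apply: sumr_ge0 => z _; apply: nsq_ge0. Qed.

(** Passing to moduli removes the phases [e l (bit_drop j z)], so the gap of the core applies at
    every character. *)
Let Var_le l : gam * Var l <= w l.
Proof.
have := hgap (fun z => (r l z)%:C).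
have -> : cmean (fun z => (r l z)%:C) = (m l)%:C.
  by rewrite /cmean /m rmorphM fmorphV rmorph_nat rmorph_sum.
under eq_bigr => z _ do rewrite -rmorphB nsqR.
move=> /le_trans; apply; apply: ler_sum => j _; apply: ler_sum => z _.
rewrite -rmorphB nsqR; apply: le_trans (cnorm_sqrB_le _ _).
by rewrite cnormM (cnorm_pair he) mul1r.
Qed.

(** Where [|g l|] is close to its mean [m l], the phases [e l (a p z)], far from 1 on average, force
    [v p l] to be at least a constant multiple of [m l ^+ 2 * #|Z|]. *)
Let high_le l : ~~ L l -> s l <= 16%:R * (v true l + v false l) + 66%:R * Var l.
Proof.
move=> /high_kill[p hp].
have X1 z : cnorm (e l (a p z)) = 1 by apply: cnorm_pair.
have X4 z : nsq (e l (a p z) - 1) <= 4%:R.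
  by have := nsqD_le (e l (a p z)) (-1); rewrite nsqN nsq1 (nsq_pair he); lra.
have := sum_nsqB1 X1; set X := \sum_z nsq _ => hX.
have mX : m l ^+ 2 * X <= 2%:R * v p l + 8%:R * Var l.
  rewrite /X /v /Var !mulr_sumr -big_split /=; apply: ler_sum => z _.
  have -> : e l (a p z) * g l z - g l z = g l z * (e l (a p z) - 1) by ring.
  rewrite nsqM -[nsq (g l z)]cnorm_sqr -/(r l z).
  have := X4 z; have := nsq_ge0 (e l (a p z) - 1).
  move: (nsq _) (r l z) (m l) => n r1 m1 n0 n4.
  have : m1 ^+ 2 <= 2%:R * r1 ^+ 2 + 2%:R * (r1 - m1) ^+ 2.
    by have := sqr_ge0 (2%:R * r1 - m1); lra.
  have := sqr_ge0 (r1 - m1); nra.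
have sm : s l <= 2%:R * m l ^+ 2 * #|Z|%:R + 2%:R * Var l.
  have -> : 2%:R * m l ^+ 2 * #|Z|%:R = \sum_(z : Z) 2%:R * m l ^+ 2.
    by rewrite sumr_const -[RHS]mulr_natr.
  rewrite /s /Var mulr_sumr -big_split /=.
  apply: ler_sum => z _; rewrite -cnorm_sqr -/(r l z).
  by have := sqr_ge0 (r l z - 2%:R * m l); lra.
have vv : v p l <= v true l + v false l.
  by case: (p); rewrite ?lerDl ?lerDr v_ge0.
have : #|Z|%:R / 4%:R <= X by lra.
have := sqr_ge0 (m l); have := Var_ge0 l; nra.
Qed.

(** At a low character the phase of [bit_drop] is nearly 1; dropping it leaves the core gap for
    [g l] itself and not only for its modulus. *)
Let low_le l : L l -> gam * t l <= 2%:R * w l + 2%:R * #|J|%:R * rho2 * s l.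
Proof.
move=> Ll; apply: le_trans (hgap (g l)) _.
have -> : 2%:R * #|J|%:R * rho2 * s l = \sum_(j : J) 2%:R * rho2 * s l.
  by rewrite sumr_const -[RHS]mulr_natl; ring.
rewrite /w mulr_sumr -big_split; apply: ler_sum => j _ /=.
have -> : s l = \sum_z nsq (g l (sigma j z)).
  by rewrite /s (reindex_inj (@sigma_inj j)).
rewrite !mulr_sumr -big_split; apply: ler_sum => z _ /=.
set A := g l _; set B := g l _; set E := e l _.
have -> : A - B = (E * A - B) + (1 - E) * A by ring.
apply: le_trans (nsqD_le _ _) _; rewrite lerD2l nsqM -mulrA ler_pM2l ?ltr0n //.
by rewrite ler_wpM2r ?nsq_ge0 // nsqC low_flat.
Qed.

Let D l := if L l then t l else s l.

Let D_le l : gam * D l <=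
  16%:R * gam * (v true l + v false l) + 68%:R * w l + 2%:R * #|J|%:R * rho2 * s l.
Proof.
have := Var_le l; have := s_ge0 l; have := w_ge0 l.
have := v_ge0 true l; have := v_ge0 false l.
rewrite /D; case: ifPn => [/low_le|/high_le].
  have := mulr_ge0 (ltW gam_gt0) (v_ge0 true l).
  have := mulr_ge0 (ltW gam_gt0) (v_ge0 false l); lra.
move=> hs _ _ w0 s0 hv.
have : 0 <= 2%:R * #|J|%:R * rho2 * s l by rewrite !mulr_ge0.
have : gam * s l <= gam * (16%:R * (v true l + v false l) + 66%:R * Var l).
  by rewrite ler_pM2l.
lra.
Qed.

(** [G] is a function of the fibre alone: the low part of the average of [f] over the core. Its
    squared distance to [f] is [dist]. *)
Let chat l := if L l then c l else 0.
Let G := synthesis e chat.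

Let fourierG l : fourier e G l = chat l.
Proof. exact: fourier_synthesis. Qed.

Let normf := \sum_z \sum_u nsq (f z u).
Let dist := \sum_z \sum_u nsq (f z u - G u).
Let normG := \sum_u nsq (G u).
Let QW := \sum_j \sum_z \sum_u nsq (f (sigma j z) (u + bit_drop j z) - f z u).
Let QV p := \sum_z \sum_u nsq (f z (u + a p z) - f z u).
Let QF p := \sum_x nsq (f (F p x).1 (F p x).2 - f x.1 x.2).
Let H p := \sum_z \sum_u nsq (G (u + h p z) - G u).

Let sum_s : \sum_l s l = #|U|%:R * normf.
Proof.
rewrite /s /normf exchange_big mulr_sumr /=; apply: eq_bigr => z _.
by rewrite -(parseval he).
Qed.

Let sum_w : \sum_l w l = #|U|%:R * QW.
Proof.
rewrite /w /QW exchange_big mulr_sumr /=; apply: eq_bigr => j _.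
rewrite exchange_big mulr_sumr /=; apply: eq_bigr => z _.
rewrite -(parseval he); apply: eq_bigr => l _.
by rewrite fourierB (fourier_shift he).
Qed.

Let sum_v p : \sum_l v p l = #|U|%:R * QV p.
Proof.
rewrite /v /QV exchange_big mulr_sumr /=; apply: eq_bigr => z _.
rewrite -(parseval he); apply: eq_bigr => l _.
by rewrite fourierB (fourier_shift he).
Qed.

Let sum_D : \sum_l D l = #|U|%:R * dist.
Proof.
rewrite /dist mulr_sumr.
under [RHS]eq_bigr => z _ do rewrite -(parseval he).
rewrite exchange_big /=; apply: eq_bigr => l _.
rewrite /D /t /s; case: ifPn => Ll; apply: eq_bigr => z _.
  by rewrite fourierB fourierG /chat Ll.
by rewrite fourierB fourierG /chat (negPf Ll) subr0.
Qed.

Let dist_le : gam * dist <=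
  16%:R * gam * (QV true + QV false) + 68%:R * QW + 2%:R * #|J|%:R * rho2 * normf.
Proof.
rewrite -(ler_pM2l NU_gt0).
have -> : #|U|%:R * (gam * dist) = \sum_l gam * D l.
  by rewrite -mulr_sumr sum_D; ring.
apply: (le_trans (ler_sum _ (fun l _ => D_le l))).
rewrite !big_split /= -!mulr_sumr big_split /= !sum_v sum_w sum_s.
by rewrite le_eqVlt; apply/orP; left; apply/eqP; ring.
Qed.

Let chat0 : chat 0 = 0.
Proof.
rewrite /chat; case: ifP => // _; rewrite /c /cmean.
have -> : \sum_z g 0 z = 0; last by rewrite mulr0.
rewrite -[RHS]f0; apply: eq_bigr => z _; rewrite /g /fourier.
by apply: eq_bigr => u _; rewrite (pair0r he) conjc1 mulr1.
Qed.

Let sum_chat : \sum_l nsq (chat l) = #|U|%:R * normG.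
Proof. by rewrite -(parseval he); apply: eq_bigr => l _; rewrite fourierG. Qed.

(** A nonzero coefficient of [G] sits at a nontrivial low character, by [chat0], and there one of
    the translations by [h] has phases far from 1. *)
Let H_ge : #|Z|%:R * normG <= 2%:R * (H true + H false).
Proof.
pose n p l := nsq (chat l) * \sum_z nsq (e l (h p z) - 1).
have n_ge0 p l : 0 <= n p l.
  by rewrite mulr_ge0 ?nsq_ge0 // sumr_ge0 // => z _; apply: nsq_ge0.
have HE p : #|U|%:R * H p = \sum_l n p l.
  rewrite mulr_sumr; under eq_bigr => z _ do rewrite -(parseval he).
  rewrite exchange_big; apply: eq_bigr => l _ /=; rewrite /n mulr_sumr.
  apply: eq_bigr => z _; rewrite fourierB (fourier_shift he) fourierG -nsqM.
  by congr nsq; ring.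
rewrite -(ler_pM2l NU_gt0) mulrCA -sum_chat [leRHS]mulrCA mulrDr !HE -big_split /=.
rewrite !mulr_sumr; apply: ler_sum => l _.
have [->|cl] := eqVneq (chat l) 0.
  by rewrite nsq0 mulr0 mulr_ge0 ?ler0n ?addr_ge0.
have Ll : L l by move: cl; rewrite /chat; case: ifP => //; rewrite eqxx.
have l0 : l != 0 by apply: contra_neq cl => ->.
have [p hp] := low_kill Ll l0.
have np : n p l <= n true l + n false l by case: (p); rewrite ?lerDl ?lerDr n_ge0.
apply: le_trans (_ : 2%:R * n p l <= _); last by rewrite ler_pM2l ?ltr0n.
have := sum_nsqB1 (fun z => cnorm_pair he l (h p z)).
have := nsq_ge0 (chat l); rewrite /n; move: (nsq _) (\sum_z nsq _) => A B A0 AB.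
have : #|Z|%:R / 2%:R <= B by lra.
nra.
Qed.

(** Four steps lead from [G (u + h p z)] to [G u]: to [G] after [F p], to [f] after [F p], to [f]
    before it, and back to [G]. *)
Let H_le p : H p <= 4%:R * (rho2 * (#|Z|%:R * normG) + 2%:R * dist + QF p).
Proof.
have hc : \sum_x nsq (G (F p x).2 - G (x.2 + h p x.1)) <= rho2 * #|Z|%:R * normG.
  by apply: low_carry => l; rewrite fourierG /chat => /negPf->.
have distE : dist = \sum_x nsq (f x.1 x.2 - G x.2) by rewrite /dist pair_bigA.
have distF : dist = \sum_x nsq (f (F p x).1 (F p x).2 - G (F p x).2).
  by rewrite distE (reindex_inj (@F_inj p)).
apply: le_trans (_ : 4%:R * (\sum_x nsq (G (F p x).2 - G (x.2 + h p x.1)) +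
   dist + QF p + dist) <= _); last by rewrite ler_pM2l ?ltr0n //; lra.
rewrite [in X in _ + X]distE distF /QF /H pair_bigA -!big_split /= mulr_sumr.
apply: ler_sum => x _.
set A := G (_ + _); set B := G x.2; set C := G _; set D1 := f _ _; set E := f _ _.
rewrite (nsqC C A) (nsqC D1 C).
apply: le_trans (nsqD4_le (A - C) (C - D1) (D1 - E) (E - B)).
by rewrite le_eqVlt; apply/orP; left; apply/eqP; congr nsq; ring.
Qed.

Let normf_le : normf <= 2%:R * dist + 2%:R * (#|Z|%:R * normG).
Proof.
have -> : #|Z|%:R * normG = \sum_(z : Z) \sum_u nsq (G u).
  by rewrite sumr_const mulr_natl.
rewrite /normf /dist !mulr_sumr -big_split; apply: ler_sum => z _ /=.
rewrite !mulr_sumr -big_split; apply: ler_sum => u _ /=.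
by have := nsqD_le (f z u - G u) (G u); rewrite subrK.
Qed.

(** [dist_le] controls the distance from [f] to [G], and [H_ge] with [H_le] the norm of [G]. The
    error terms carry the factors [16 * rho2 <= 1 / 2] and [260 * #|J| * rho2 <= gam / 2] and are
    absorbed; the constant is [2 * 130 * 68]. *)
Lemma skew_gap : gam * normf <=
  17680%:R * (QW + (QV true + QV false) + (QF true + QF false)).
Proof.
have QV_ge0 p : 0 <= QV p.
  by apply: sumr_ge0 => z _; apply: sumr_ge0 => u _; apply: nsq_ge0.
have QF_ge0 p : 0 <= QF p by apply: sumr_ge0 => x _; apply: nsq_ge0.
have QW_ge0 : 0 <= QW.
  by do 3! (apply: sumr_ge0 => ? _); apply: nsq_ge0.
have nf0 : 0 <= normf by do 2! (apply: sumr_ge0 => ? _); apply: nsq_ge0.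
have nG0 : 0 <= #|Z|%:R * normG.
  by rewrite mulr_ge0 ?ler0n //; apply: sumr_ge0 => u _; apply: nsq_ge0.
have := H_ge; have := H_le true; have := H_le false.
have := normf_le; have := dist_le.
have d0 : 0 <= dist by do 2! (apply: sumr_ge0 => ? _); apply: nsq_ge0.
have := QV_ge0 true; have := QV_ge0 false; have := QF_ge0 true; have := QF_ge0 false.
move: (QV true) (QV false) (QF true) (QF false) (H true) (H false) => q1 q2 q3 q4 h1 h2.
move=> q40 q30 q20 q10 hd hn hh2 hh1 hH.
have hr : rho2 * (#|Z|%:R * normG) <= 1 / 32%:R * (#|Z|%:R * normG).
  by rewrite ler_wpM2r.
have hJ : 520%:R * #|J|%:R * rho2 * normf <= gam * normf by rewrite ler_wpM2r.
have hg : #|Z|%:R * normG <= 64%:R * dist + 16%:R * (q3 + q4) by lra.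
have hnf : normf <= 130%:R * dist + 32%:R * (q3 + q4) by lra.
have : gam * normf <= 130%:R * (gam * dist) + 32%:R * (gam * (q3 + q4)).
  by have : gam * normf <= gam * (130%:R * dist + 32%:R * (q3 + q4)); [rewrite ler_pM2l | lra].
have : gam * (q3 + q4) <= q3 + q4 by rewrite ler_piMl ?addr_ge0.
have : gam * (q1 + q2) <= q1 + q2 by rewrite ler_piMl ?addr_ge0.
lra.
Qed.

End SkewGap.

(** * The affine core *)

Section PingPong.
Local Open Scope ring_scope.
Variables (R : rcfType) (V : finType) (tau : V -> V) (phi : V -> R[i]).
Variables (D C1 C2 C3 : pred V).
Hypothesis tau_inj : injective tau.
Hypothesis DC1 : forall v, D v -> C1 v.
Hypothesis DC2 : forall v, D v -> C2 (tau v).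
Hypothesis DC3 : forall v, D v -> C3 (tau (tau v)).
Hypothesis C12 : forall v, C1 v -> ~~ C2 v.
Hypothesis C13 : forall v, C1 v -> ~~ C3 v.
Hypothesis C23 : forall v, C2 v -> ~~ C3 v.

(* The mass of [D] is almost preserved along [tau], and [D], [tau D] and
   [tau (tau D)] are disjoint. *)
Lemma ping_pong_mass :
  13%:R * \sum_(v | D v) nsq (phi v) <=
  5%:R * \sum_v nsq (phi v) + 100%:R * \sum_v nsq (phi (tau v) - phi v).
Proof.
set q := \sum_v nsq (phi (tau v) - phi v).
pose q2 := \sum_v nsq (phi (tau (tau v)) - phi v).
have q2_le : q2 <= 4%:R * q.
  have -> : 4%:R * q = 2%:R * \sum_v nsq (phi (tau (tau v)) - phi (tau v)) + 2%:R * q.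
    have -> : \sum_v nsq (phi (tau (tau v)) - phi (tau v)) = q.
      by rewrite /q [RHS](reindex_inj tau_inj).
    ring.
  rewrite !mulr_sumr -big_split; apply: ler_sum => v _ /=.
  apply: le_trans (nsqD_le _ _); rewrite le_eqVlt; apply/orP; left; apply/eqP.
  by congr nsq; ring.
have step (psi : V -> R[i]) (C : pred V) (s : V -> V) :
    injective s -> (forall v, D v -> C (s v)) ->
    4%:R * \sum_(v | D v) nsq (phi v) <=
    5%:R * \sum_(v | C v) nsq (phi v) + 20%:R * \sum_v nsq (phi (s v) - phi v).
  move=> s_inj DC; have : \sum_(v | D v) nsq (phi (s v)) <= \sum_(v | C v) nsq (phi v).
    rewrite [leRHS](reindex_inj s_inj) [leLHS]big_mkcond [leRHS]big_mkcond.
    apply: ler_sum => v _; case: ifPn => [/DC->//|_].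
    by case: ifP; rewrite ?nsq_ge0.
  have : 4%:R * \sum_(v | D v) nsq (phi v) <=
      5%:R * \sum_(v | D v) nsq (phi (s v)) + 20%:R * \sum_(v | D v) nsq (phi (s v) - phi v).
    rewrite !mulr_sumr -big_split; apply: ler_sum => v _ /=.
    by have := nsqB_le_strong (phi v) (phi (s v)); rewrite nsqC; lra.
  have : \sum_(v | D v) nsq (phi (s v) - phi v) <= \sum_v nsq (phi (s v) - phi v).
    rewrite [leLHS]big_mkcond; apply: ler_sum => v _.
    by case: ifP; rewrite ?nsq_ge0.
  lra.
have h2 := step phi C2 tau tau_inj DC2.
have h3 := step phi C3 _ (inj_comp tau_inj tau_inj) DC3.
have h1 : \sum_(v | D v) nsq (phi v) <= \sum_(v | C1 v) nsq (phi v).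
  rewrite [leLHS]big_mkcond [leRHS]big_mkcond; apply: ler_sum => v _.
  by case: ifPn => [/DC1->//|_]; case: ifP; rewrite ?nsq_ge0.
have : \sum_(v | C1 v) nsq (phi v) + \sum_(v | C2 v) nsq (phi v) +
       \sum_(v | C3 v) nsq (phi v) <= \sum_v nsq (phi v).
  rewrite [X in X + _ + _]big_mkcond [X in _ + X + _]big_mkcond [X in _ + X]big_mkcond.
  rewrite -!big_split; apply: ler_sum => v _ /=.
  have := nsq_ge0 (phi v); have := @C12 v; have := @C13 v; have := @C23 v.
  case: (C1 v); case: (C2 v); case: (C3 v) => //=; rewrite ?add0r ?addr0 //.
  - by move=> _ _ /(_ isT).
  - by move=> _ _ /(_ isT).
  - by move=> _ /(_ isT).
  - by move=> /(_ isT).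
rewrite -/q /= -/q2 in h2 h3 *; lra.
Qed.

End PingPong.

HB.instance Definition _ (A B : finZmodType) := Algebra.Zmodule.on (A * B)%type.

(** * Spectral gap of the shears and unit translations *)

Section AffineGap.
Local Open Scope ring_scope.
Local Open Scope complex_scope.
Variables (R : rcfType) (A : finZmodType) (e : A -> A -> R[i]) (one : A).
Hypothesis he : pairing e.
Hypothesis one_gen : forall x, e x one = 1 -> x = 0.

Definition pairing2 (v w : A * A) : R[i] := e v.1 w.1 * e v.2 w.2.

Lemma pairing2P : pairing pairing2.
Proof.
split=> [x y z|x y|x y|[x1 x2]].
- by rewrite /pairing2 /= !(pairDr he); ring.
- by rewrite /pairing2 !(pairC he y.1) !(pairC he y.2).
- by rewrite /pairing2 cnormM !(cnorm_pair he) mulr1.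
- move=> nz; have : (x1 != 0) || (x2 != 0).
    by move: nz; apply: contraNT; rewrite negb_or !negbK => /andP[/eqP-> /eqP->].
  case/orP => /(pair_nz he)[y hy].
    by exists (y, 0); rewrite /pairing2 /= (pairr0 he) mulr1.
  by exists (0, y); rewrite /pairing2 /= (pairr0 he) mul1r.
Qed.

Definition affine_gen (j : bool * bool) (z : A * A) : A * A :=
  match j with
  | (false, false) => (z.1 + z.2 *+ 4, z.2)
  | (false, true) => (z.1, z.2 + z.1 *+ 4)
  | (true, false) => (z.1 + one, z.2)
  | (true, true) => (z.1, z.2 + one)
  end.

Lemma affine_gen_inj j : injective (affine_gen j).
Proof.
case: j => [[] []] [a b] [c d] /=.
- by case=> -> /addIr->.
- by case=> /addIr-> ->.
- by case=> -> /addIr->.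
- by case=> /[swap] -> /addIr->.
Qed.

Let s (x : A) : R := cnorm (e x one - 1).

Let s_eq0 x : s x = 0 -> x = 0.
Proof. by move/eqP; rewrite cnorm_eq0 subr_eq0 => /eqP/one_gen. Qed.

(** Second-order expansion of [y ^+ n] at [y = 1]: small sizes grow almost linearly under
    multiplication by [n]. *)
Let s_mul x n : cnorm (e (x *+ n) one - 1 - n%:R * (e x one - 1)) <= 'C(n, 2)%:R * s x ^+ 2.
Proof.
rewrite (pairMnl he); set y := e x one.
elim: n => [|n IH].
  by rewrite expr0 subrr mul0r subr0 cnorm0 mul0r.
have -> : y ^+ n.+1 - 1 - n.+1%:R * (y - 1) =
  (y ^+ n - 1 - n%:R * (y - 1)) + (y - 1) * (y ^+ n - 1) by rewrite exprS -natr1; ring.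
apply: le_trans (cnormD _ _) _; rewrite binS bin1 natrD [leRHS]mulrDl lerD //.
rewrite cnormM mulrC -/(s x) expr2 mulrA ler_wpM2r ?cnorm_ge0 //.
by apply: cnorm_subX1; apply: cnorm_pair.
Qed.

Let s_mul_le x n : s (x *+ n) <= n%:R * s x.
Proof. by rewrite /s (pairMnl he); apply: cnorm_subX1; apply: cnorm_pair. Qed.

Let s_mul_ge x n : n%:R * s x - 'C(n, 2)%:R * s x ^+ 2 <= s (x *+ n).
Proof.
have := s_mul x n; set y := e (_ *+ _) _ - 1; set c := n%:R * (e x one - 1).
have := cnormB c y; rewrite (cnormC c y) /c cnormM cnorm_nat -/(s x) -/(s (x *+ n)).
lra.
Qed.

Let s_sub x y : s (y - x) = cnorm ((e y one - 1) - (e x one - 1)).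
Proof.
have -> : e y one - 1 - (e x one - 1) = (e (y - x) one - 1) * e x one.
  by rewrite mulrBl -(pairDl he) subrK; ring.
by rewrite cnormM (cnorm_pair he) mulr1.
Qed.

Let s_sub_le x y : s (y - x) <= s y + s x.
Proof. by rewrite s_sub; apply: le_trans (cnormD _ _) _; rewrite cnormN. Qed.

Let s_sub_ge x y : s x - s y <= s (y - x).
Proof. by rewrite s_sub cnormC; apply: cnormB. Qed.

Let s_ge0 x : 0 <= s x. Proof. exact: cnorm_ge0. Qed.

(** A cone of small vectors with dominant first coordinate. As ['C(8, 2) = 28], the bound [1 / 28]
    gives [s (x *+ 8) >= 7 * s x] there. [tau] is dual to the first shear. *)
Let D (v : A * A) := [&& v != 0, s v.2 <= s v.1 & s v.1 <= 1 / 28%:R].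
Let tau (v : A * A) := (v.1, v.2 - v.1 *+ 4).

Let tau_inj : injective tau.
Proof. by move=> [a b] [c d] [-> /addIr->]. Qed.

Let shear_mass (phi : A * A -> R[i]) :
  13%:R * \sum_(v | D v) nsq (phi v) <=
  5%:R * \sum_v nsq (phi v) + 100%:R * \sum_v nsq (phi (tau v) - phi v).
Proof.
have Dpos v : D v -> 0 < s v.1.
  case: v => x y /and3P[/= nz le_yx _]; rewrite lt_def s_ge0 andbT.
  apply: contraNN nz => /eqP s0; rewrite s0 in le_yx.
  have /s_eq0-> : s y = 0 by apply/eqP; rewrite eq_le le_yx s_ge0.
  by rewrite (s_eq0 s0).
have c4 : 'C(4, 2) = 6 by [].
have c8 : 'C(8, 2) = 28 by [].
(* The ratio of the second size to the first is at most 1 on [D], between 1 and 5 after one shear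
   and above 5 after two. *)
apply: (@ping_pong_mass R _ tau phi D (fun v => s v.2 <= s v.1)
  (fun v => s v.1 < s v.2 <= 5%:R * s v.1) (fun v => 5%:R * s v.1 < s v.2)).
- exact: tau_inj.
- by move=> v /and3P[].
- move=> [x y] Dv; have /= x0 := Dpos _ Dv; case/and3P: Dv => /= _ yx xd.
  have := s_sub_le (x *+ 4) y; have := s_sub_ge (x *+ 4) y.
  have := s_mul_le x 4; have := s_mul_ge x 4; rewrite c4 => h1 h2 h3 h4.
  by apply/andP; split; nra.
- move=> [x y] Dv; have /= x0 := Dpos _ Dv; case/and3P: Dv => /= _ yx xd.
  rewrite -addrA -opprD -mulrnDr -[(4 + 4)%N]/8%N.
  have := s_sub_ge (x *+ 8) y; have := s_mul_ge x 8; rewrite c8 => h1 h2; nra.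
- by move=> [x y] /= le_yx; rewrite negb_and -leNgt le_yx.
- move=> [x y] /= le_yx; rewrite -leNgt; have := s_ge0 x; lra.
- by move=> [x y] /= /andP[_]; rewrite leNgt.
Qed.

Let swap (v : A * A) := (v.2, v.1).
Let swap_inj : injective swap. Proof. by move=> [a b] [c d] [-> ->]. Qed.

(** A nonzero vector lies in [D], in its mirror image, or has a coordinate of size above [1 / 28].
    Up to the energies of the shears the two cones carry at most [10 / 13] of the mass, and the rest
    is seen by the multiplications, whose energy there is at least [1 / 784 = (1 / 28) ^ 2] of
    it. *)
Let affine_mass (phi : A * A -> R[i]) : phi 0 = 0 ->
  \sum_v nsq (phi v) <= 4000%:R * (
     \sum_v nsq (phi (v.1, v.2 - v.1 *+ 4) - phi v) +
     \sum_v nsq (phi (v.1 - v.2 *+ 4, v.2) - phi v) +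
     \sum_v nsq (e v.1 one * phi v - phi v) +
     \sum_v nsq (e v.2 one * phi v - phi v)).
Proof.
move=> phi0; have h1 := shear_mass phi; have h2 := shear_mass (phi \o swap).
set S := \sum_v nsq (phi v) in h1 *.
have S2 : \sum_v nsq ((phi \o swap) v) = S by rewrite [RHS](reindex_inj swap_inj).
have q2E : \sum_v nsq ((phi \o swap) (tau v) - (phi \o swap) v) =
  \sum_v nsq (phi (v.1 - v.2 *+ 4, v.2) - phi v).
  by rewrite [RHS](reindex_inj swap_inj).
have D2E : \sum_(v | D v) nsq ((phi \o swap) v) = \sum_(v | D (swap v)) nsq (phi v).
  by rewrite [RHS](reindex_inj swap_inj); apply: eq_bigl => -[].
rewrite S2 q2E D2E in h2; rewrite /tau in h1.
move: h1 h2; set q1 := \sum_v nsq (phi (_, _ - _) - _).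
set q2 := \sum_v nsq (phi (_ - _, _) - _) => h1 h2.
set q3 := \sum_v nsq (e v.1 one * _ - _); set q4 := \sum_v nsq (e v.2 one * _ - _).
have tr (x : A * A -> A) : \sum_(v | 1 / 28%:R < s (x v)) nsq (phi v) <=
    784%:R * \sum_v nsq (e (x v) one * phi v - phi v).
  rewrite big_mkcond mulr_sumr; apply: ler_sum => v _; case: ifPn => [lt_s|_].
    have -> : e (x v) one * phi v - phi v = (e (x v) one - 1) * phi v by ring.
    rewrite nsqM -[nsq (e _ _ - 1)]cnorm_sqr -/(s (x v)).
    have : 1 <= 784%:R * s (x v) ^+ 2 by nra.
    by have := nsq_ge0 (phi v); nra.
  by rewrite mulr_ge0 ?ler0n ?nsq_ge0.
have h3 := tr fst; have h4 := tr snd.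
have : S <= \sum_(v | D v) nsq (phi v) + \sum_(v | D (swap v)) nsq (phi v) +
    \sum_(v | 1 / 28%:R < s v.1) nsq (phi v) + \sum_(v | 1 / 28%:R < s v.2) nsq (phi v).
  rewrite (big_mkcond D) (big_mkcond (fun v => D (swap v))) /=.
  rewrite (big_mkcond (fun v => _ < s v.1)) (big_mkcond (fun v => _ < s v.2)) /=.
  rewrite -!big_split /S; apply: ler_sum => -[x y] _ /=.
  have n0 := nsq_ge0 (phi (x, y)).
  have [->|nz] := eqVneq (x, y) 0.
    by rewrite phi0 nsq0 !if_same !addr0.
  rewrite /D /swap /= nz (_ : (y, x) != 0) /=; last first.
    by apply: contraNN nz => /eqP[-> ->].
  have ge0 (b : bool) : 0 <= (if b then nsq (phi (x, y)) else 0) by case: b.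
  have [lt1|le1] := ltP (1 / 28%:R) (s x).
    by rewrite -[leLHS]add0r -addrA lerD ?addr_ge0 ?lerDl.
  have [lt2|le2] := ltP (1 / 28%:R) (s y); first by rewrite lerDr ?addr_ge0.
  rewrite !andbT !addr0; have [le_yx|] := leP (s y) (s x); first by rewrite lerDl.
  by move/ltW->; rewrite add0r.
rewrite -/q3 -/q4 in h3 h4.
have pos (q : A * A -> R[i]) : 0 <= \sum_v nsq (q v) by apply: sumr_ge0 => v _; apply: nsq_ge0.
have : 0 <= q1 by apply: pos.
have : 0 <= q2 by apply: pos.
have : 0 <= q3 by apply: pos.
have : 0 <= q4 by apply: pos.
lra.
Qed.

(** On the Fourier side the shears become inverse transposed shears and the translations
    multiplications by characters; subtracting the mean kills the coefficient at 0. *)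
Lemma affine_gap : spectral_gap affine_gen (1 / 4000%:R : R).
Proof.
move=> g; pose g0 z := g z - cmean g.
have e2 := pairing2P.
have NZ : 0 < #|((A * A)%type : finType)|%:R :> R.
  by rewrite ltr0n; apply/card_gt0P; exists 0.
pose phi := fourier pairing2 g0.
have phi0 : phi 0 = 0.
  rewrite /phi /fourier; under eq_bigr => u _ do rewrite (pair0r e2) conjc1 mulr1.
  rewrite /g0 sumrB sumr_const /cmean -[_ *+ #|_|]mulr_natl mulrA mulfV ?mul1r ?subrr //.
  exact: card_neq0.
have qE (sg : A * A -> A * A) : \sum_z nsq (g (sg z) - g z) =
    \sum_z nsq (g0 (sg z) - g0 z).
  by apply: eq_bigr => z _; congr nsq; rewrite /g0; ring.
rewrite -(ler_pM2l NZ) mulrCA -/(g0 _) -(parseval e2).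
have -> : \sum_j \sum_z nsq (g (affine_gen j z) - g z) =
  \sum_z nsq (g (z.1 + z.2 *+ 4, z.2) - g z) + \sum_z nsq (g (z.1, z.2 + z.1 *+ 4) - g z) +
  \sum_z nsq (g (z.1 + one, z.2) - g z) + \sum_z nsq (g (z.1, z.2 + one) - g z).
  transitivity (\sum_i \sum_j \sum_z nsq (g (affine_gen (i, j) z) - g z)).
    by rewrite [RHS]pair_bigA; apply: eq_bigr => -[].
  rewrite !big_bool /=; ring.
have bil x b : e x (b *+ 4) = e (x *+ 4) b by rewrite (pairMn he) (pairMnl he).
have shear1 v : fourier pairing2 (fun z => g0 (z.1 + z.2 *+ 4, z.2)) v =
    phi (v.1, v.2 - v.1 *+ 4).
  rewrite /phi /fourier.
  rewrite [RHS](reindex_inj (h := fun z : A * A => (z.1 + z.2 *+ 4, z.2))) /=.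
    apply: eq_bigr => z _; congr (_ * conjc _); rewrite /pairing2 /=.
    by rewrite (pairDr he) bil -mulrA -(pairDl he) addrC subrK.
  by move=> [a b] [c d] [/[swap] -> /addIr->].
have shear2 v : fourier pairing2 (fun z => g0 (z.1, z.2 + z.1 *+ 4)) v =
    phi (v.1 - v.2 *+ 4, v.2).
  rewrite /phi /fourier.
  rewrite [RHS](reindex_inj (h := fun z : A * A => (z.1, z.2 + z.1 *+ 4))) /=.
    apply: eq_bigr => z _; congr (_ * conjc _); rewrite /pairing2 /=.
    by rewrite (pairDr he) bil [RHS]mulrCA -(pairDl he) subrK mulrC.
  by move=> [a b] [c d] [-> /addIr->].
have tr1 v : fourier pairing2 (fun z => g0 (z.1 + one, z.2)) v = e v.1 one * phi v.
  rewrite -[e _ _]mulr1 -(pairr0 he v.2) -[_ * e _ 0]/(pairing2 v (one, 0)) -(fourier_shift e2).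
  by apply: eq_bigr => -[z1 z2] _; rewrite -[(z1, z2) + _]/(z1 + one, z2 + 0) addr0.
have tr2 v : fourier pairing2 (fun z => g0 (z.1, z.2 + one)) v = e v.2 one * phi v.
  rewrite -[e _ _]mul1r -(pairr0 he v.1) -[e _ 0 * _]/(pairing2 v (0, one)) -(fourier_shift e2).
  by apply: eq_bigr => -[z1 z2] _; rewrite -[(z1, z2) + _]/(z1 + 0, z2 + one) addr0.
have sum4 (sg : A * A -> A * A) (G : A * A -> R[i]) :
    (forall v, fourier pairing2 (fun z => g0 (sg z)) v = G v) ->
    #|((A * A)%type : finType)|%:R * \sum_z nsq (g (sg z) - g z) =
    \sum_v nsq (G v - phi v).
  move=> FG; rewrite qE -(parseval e2); apply: eq_bigr => v _.
  by rewrite fourierB FG.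
have := affine_mass phi0; rewrite -(sum4 _ _ shear1) -(sum4 _ _ shear2).
rewrite -(sum4 _ _ tr1) -(sum4 _ _ tr2) /= -!mulrDr.
move=> mass; apply: (le_trans (ler_wpM2l _ mass)); first by rewrite divr_ge0 ?ler0n.
by rewrite div1r mulKf ?pnatr_eq0.
Qed.

End AffineGap.

(** * Digits and bits *)

Section Roots.
Local Open Scope ring_scope.
Local Open Scope complex_scope.
Variable R : rcfType.

(** A primitive root of unity of order [2 ^ k], from iterated square roots of [-1], which exist over
    any real closed field. *)
Definition root2 (k : nat) : R[i] := if k is k'.+1 then iter k' (@sqrtc R) (-1) else 1.

Lemma root2_half k : root2 k.+1 ^+ (2 ^ k) = -1.
Proof.
elim: k => [|k IH]; first by rewrite expr1.
by rewrite expnS mulnC exprM -exprM mulnC exprM -[root2 k.+2]/(sqrtc (root2 k.+1)) sqr_sqrtc.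
Qed.

Lemma root2_prim k : (2 ^ k).-primitive_root (root2 k).
Proof.
case: k => [|k].
  have [m hm] := prim_order_exists (isT : 0 < 1)%N (expr1 (1 : R[i])).
  by rewrite dvdn1 => /eqP E; move: hm; rewrite E.
have full : root2 k.+1 ^+ (2 ^ k.+1) = 1 by rewrite expnSr exprM root2_half sqrrN expr1n.
have [m hm md] := prim_order_exists (expn_gt0 2 k.+1) full.
have /(dvdn_pfactor _ _ (isT : prime 2))[j le_j E] := md.
move: le_j; rewrite leq_eqVlt => /orP[/eqP ej|]; first by move: hm; rewrite E ej.
rewrite ltnS => le_jk; have : root2 k.+1 ^+ (2 ^ k) = 1.
  by apply/eqP; rewrite -(prim_order_dvd hm) E dvdn_exp2l.
rewrite root2_half => /eqP; rewrite eqr_oppLR -subr_eq0 opprK.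
by rewrite -[1 + 1]/(2%:R) pnatr_eq0.
Qed.

Lemma cnorm_root2 k : cnorm (root2 k) = 1.
Proof.
have := cnormX (root2 k) (2 ^ k); rewrite (prim_expr_order (root2_prim k)) cnorm1.
by move/esym/eqP; rewrite pexpr_eq1 ?expn_gt0 ?cnorm_ge0 // => /eqP.
Qed.

End Roots.

Section CyclicPairing.
Local Open Scope ring_scope.
Local Open Scope complex_scope.
Variables (R : rcfType) (q : nat) (digit_root : R[i]).
Hypothesis digit_root_prim : q.+1.-primitive_root digit_root.
Hypothesis om1 : cnorm digit_root = 1.

Definition cyc_pair (x y : 'I_q.+1) : R[i] := digit_root ^+ (x * y).

Lemma cyc_pairP : pairing cyc_pair.
Proof.
split=> [x y z|x y|x y|x x0].
- rewrite /cyc_pair -exprD -mulnDr -(prim_expr_mod digit_root_prim) /=.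
  by rewrite modnMmr (prim_expr_mod digit_root_prim).
- by rewrite /cyc_pair mulnC.
- by rewrite /cyc_pair cnormX om1 expr1n.
- exists (inZp 1); rewrite /cyc_pair /= -(prim_expr_mod digit_root_prim) modnMmr muln1.
  rewrite (prim_expr_mod digit_root_prim) -(prim_order_dvd digit_root_prim) gtnNdvd //.
  by rewrite lt0n; apply: contraNN x0 => /eqP h; apply/eqP/val_inj.
Qed.

Lemma cyc_pair1 (x : 'I_q.+1) : cyc_pair x (inZp 1) = 1 -> x = 0.
Proof.
rewrite /cyc_pair /= -(prim_expr_mod digit_root_prim) modnMmr muln1 (prim_expr_mod digit_root_prim).
move/eqP; rewrite -(prim_order_dvd digit_root_prim) => /dvdnP[[|c] E]; first exact/val_inj.
by have := ltn_ord x; rewrite E mulSn; lia.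
Qed.

End CyclicPairing.

(** A product of cyclic groups of varying orders; the successor makes every factor a group. *)
Definition digits (K : nat) (q : nat -> nat) := {dffun forall k : 'I_K, 'I_(q k).+1}.

Section DigitGroup.
Local Open Scope ring_scope.
Variables (K : nat) (q : nat -> nat).
Local Notation U := (digits K q).
HB.instance Definition _ := Finite.on U.

Definition dadd (u v : U) : U := [ffun k => u k + v k].
Definition dopp (u : U) : U := [ffun k => - u k].
Definition dzero : U := [ffun k => 0].

Lemma daddA : associative dadd.
Proof. by move=> u v w; apply/ffunP => k; rewrite !ffunE addrA. Qed.
Lemma daddC : commutative dadd.
Proof. by move=> u v; apply/ffunP => k; rewrite !ffunE addrC. Qed.
Lemma dadd0 : left_id dzero dadd.
Proof. by move=> u; apply/ffunP => k; rewrite !ffunE add0r. Qed.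
Lemma daddN : left_inverse dzero dopp dadd.
Proof. by move=> u; apply/ffunP => k; rewrite !ffunE addNr. Qed.

HB.instance Definition _ := GRing.isZmodule.Build U daddA daddC dadd0 daddN.

Lemma digit_addE (u v : U) k : (u + v) k = u k + v k.
Proof. by rewrite ffunE. Qed.
Lemma digit0E k : (0 : U) k = 0.
Proof. by rewrite ffunE. Qed.

Definition unit_digit (k : 'I_K) : U := [ffun j => if j == k then inZp 1 else 0].

Lemma digit_muln (u : U) k n : (u *+ n) k = u k *+ n.
Proof. by elim: n => [|n IH]; rewrite ?mulr0n ?digit0E // !mulrS digit_addE IH. Qed.

Lemma digit_sum (I : Type) (r : seq I) (P : pred I) (F : I -> U) k :
  (\sum_(i <- r | P i) F i) k = \sum_(i <- r | P i) F i k.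
Proof. by elim/big_rec2: _ => [|i x y _ <-]; rewrite ?digit0E ?digit_addE. Qed.

Lemma Zp_muln1 m (x : nat) : (inZp 1 : 'I_m.+1) *+ x = inZp x.
Proof.
elim: x => [|x IH]; first by apply/val_inj; rewrite /= mod0n.
by rewrite mulrS IH; apply/val_inj; rewrite /= modnDm.
Qed.

Lemma card_digits_gt0 : (0 < #|{: U}|)%N.
Proof. by apply/card_gt0P; exists 0. Qed.

End DigitGroup.

Section DigitPairing.
Local Open Scope ring_scope.
Local Open Scope complex_scope.
Variables (R : rcfType) (K : nat) (q : nat -> nat) (digit_root : nat -> R[i]).
Hypothesis digit_root_prim : forall k, (q k).+1.-primitive_root (digit_root k).
Hypothesis om1 : forall k, cnorm (digit_root k) = 1.
Local Notation U := (digits K q).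

Definition digit_pair (u v : U) : R[i] := \prod_(k : 'I_K) cyc_pair (digit_root k) (u k) (v k).

Lemma digit_pairP : pairing digit_pair.
Proof.
have P k := cyc_pairP (digit_root_prim k) (om1 k).
split=> [x y z|x y|x y|x x0].
- rewrite /digit_pair -big_split /=; apply: eq_bigr => k _.
  by rewrite ffunE (pairDr (P k)).
- by apply: eq_bigr => k _; rewrite (pairC (P k)).
- rewrite /digit_pair; elim/big_ind: _ => [|a b ha hb|k _]; first exact: cnorm1.
    by rewrite cnormM ha hb mulr1.
  exact: (cnorm_pair (P k)).
- have [k xk] : exists k, x k != 0.
    apply/existsP; apply: contraNT x0 => /existsPn h; apply/eqP/ffunP => k.
    by rewrite digit0E; apply/eqP; rewrite -[_ == _]negbK h.
  have [y hy] := pair_nz (P k) xk.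
  exists [ffun j => if j == k then inZp y else 0].
  rewrite /digit_pair (bigD1 k) //= big1 ?mulr1 => [|j jk].
    by rewrite ffunE eqxx valZpK.
  by rewrite ffunE (negPf jk) (pairr0 (P j)).
Qed.

Lemma digit_pair_unit (l : U) k : digit_pair l (unit_digit q k) = digit_root k ^+ l k.
Proof.
rewrite /digit_pair (bigD1 k) //= big1 ?mulr1 => [|j jk].
  rewrite ffunE eqxx /cyc_pair /= -(prim_expr_mod (digit_root_prim k)) modnMmr muln1.
  by rewrite (prim_expr_mod (digit_root_prim k)).
by rewrite ffunE (negPf jk) (pairr0 (cyc_pairP (digit_root_prim j) (om1 j))).
Qed.

Lemma digit_pairE (l u : U) : digit_pair l u = \prod_(k : 'I_K) digit_pair l (unit_digit q k) ^+ u k.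
Proof.
by apply: eq_bigr => k _; rewrite digit_pair_unit /cyc_pair exprM.
Qed.

End DigitPairing.

(** * Binary expansions and carries *)

Section Bits.
Implicit Types (x y i j n : nat).

Definition bit x i : bool := odd (x %/ 2 ^ i).

Lemma modn_expS x i : x %% 2 ^ i.+1 = bit x i * 2 ^ i + x %% 2 ^ i.
Proof.
rewrite /bit -modn2; set P := 2 ^ i; rewrite expnSr -/P.
have P0 : 0 < P by rewrite expn_gt0.
rewrite {1}(divn_eq x P) {1}(divn_eq (x %/ P) 2).
rewrite mulnDl -mulnA [2 * P]mulnC -addnA modnMDl modn_small //.
have := ltn_pmod x P0; have := ltn_pmod (x %/ P) (isT : 0 < 2); nia.
Qed.

Lemma bit_modn x m i : i < m -> bit (x %% 2 ^ m) i = bit x i.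
Proof.
move=> im; rewrite /bit {2}(divn_eq x (2 ^ m)).
have -> : 2 ^ m = 2 ^ (m - i.+1) * 2 * 2 ^ i by rewrite -expnSr -expnD; congr (_ ^ _); lia.
rewrite mulnA divnMDl ?expn_gt0 // oddD mulnA muln2 -doubleMl -muln2 oddM andbF.
by [].
Qed.

Lemma eq_bit x y m i : x = y %[mod 2 ^ m] -> i < m -> bit x i = bit y i.
Proof. by move=> E im; rewrite -(bit_modn x im) E bit_modn. Qed.

Lemma eq_modn_bits x y m : (forall i, i < m -> bit x i = bit y i) -> x = y %[mod 2 ^ m].
Proof.
elim: m => [|m IH] h; first by rewrite expn0 !modn1.
by rewrite !modn_expS (h m) // IH // => i im; apply: h; apply: ltnW.
Qed.

Lemma eqn_modDl2 x y z t d : x = y %[mod d] -> z = t %[mod d] -> x + z = y + t %[mod d].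
Proof. by move=> h1 h2; rewrite -modnDm h1 h2 modnDm. Qed.

Lemma bit_addE x y i : bit (x + y) i = bit x i (+) bit (x %% 2 ^ i + y) i.
Proof.
rewrite /bit {1 2}(divn_eq x (2 ^ i)) -addnA divnMDl ?expn_gt0 // oddD.
by rewrite divnMDl ?expn_gt0 // [_ %% _ %/ _]divn_small ?ltn_pmod ?expn_gt0 // addn0.
Qed.

(** The bit [i] changes by the bit [i] of the summand and by the carry from below, and these
    residues determine both. *)
Lemma bit_add_carry x x' y y' i : x = x' %[mod 2 ^ i] -> y = y' %[mod 2 ^ i.+1] ->
  bit (x + y) i (+) bit x i = bit (x' + y') i (+) bit x' i.
Proof.
move=> digit_exp ey; rewrite bit_addE [in RHS]bit_addE ![_ (+) _ (+) _]addbC !addbA !addbb !addFb digit_exp.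
by apply: (@eq_bit _ _ i.+1) => //; apply: eqn_modDl2.
Qed.

Definition of_bits (f : nat -> bool) n := \sum_(i < n) f i * 2 ^ i.

Lemma of_bits_lt f n : of_bits f n < 2 ^ n.
Proof.
elim: n => [|n IH]; first by rewrite /of_bits big_ord0.
rewrite /of_bits big_ord_recr /= -/(of_bits f n) expnS.
case: (f n) => /=; lia.
Qed.

Lemma bit_of_bits f n i : i < n -> bit (of_bits f n) i = f i.
Proof.
elim: n => // n IH; rewrite ltnS leq_eqVlt => /orP[/eqP->|lt_in].
  rewrite /of_bits big_ord_recr /= -/(of_bits f n) /bit addnC divnMDl ?expn_gt0 //.
  by rewrite divn_small ?of_bits_lt // addn0; case: (f n).
rewrite -(bit_modn _ lt_in) /of_bits big_ord_recr /= -/(of_bits f n) addnC modnMDl.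
by rewrite modn_small ?of_bits_lt // IH.
Qed.

End Bits.

Section CoreBits.
Variables (n : nat).
Local Notation A := ('I_(2 ^ n).-1.+1).
Local Notation Z := (A * A)%type.

Lemma core_modulus : (2 ^ n).-1.+1 = 2 ^ n.
Proof. by rewrite prednK ?expn_gt0. Qed.

Definition wbit (z : Z) k : bool := bit (if odd k then z.2 else z.1) k./2.

Definition of_wbits (f : nat -> bool) : Z :=
  (inord (of_bits (fun i => f i.*2) n), inord (of_bits (fun i => f i.*2.+1) n)).

Lemma wbit_of_wbits f k : k < n.*2 -> wbit (of_wbits f) k = f k.
Proof.
move=> kn; have hn : k./2 < n by lia.
have := odd_double_half k; rewrite /wbit /of_wbits.
by case: (odd k) => /= E; rewrite inordK ?core_modulus ?of_bits_lt // bit_of_bits // -[in RHS]E.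
Qed.

Lemma eq_modn_wbit (z z' : Z) k :
  (forall j, j < k -> wbit z j = wbit z' j) ->
  z.1 = z'.1 %[mod 2 ^ (uphalf k)] /\ z.2 = z'.2 %[mod 2 ^ k./2].
Proof.
move=> h; split; apply: eq_modn_bits => i ik.
  have := h i.*2; rewrite /wbit odd_double doubleK; apply; lia.
have := h i.*2.+1; rewrite /wbit /= odd_double uphalf_double /=; apply.
by lia.
Qed.

Lemma eq_wbit (z z' : Z) : (forall j, j < n.*2 -> wbit z j = wbit z' j) -> z = z'.
Proof.
move=> /eq_modn_wbit; rewrite uphalf_double doubleK; case: z z' => [a b] [a' b'] /= [].
have s (x : A) : x %% 2 ^ n = x by rewrite modn_small // -{2}core_modulus.
by rewrite !s => /val_inj-> /val_inj->.
Qed.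

Definition flip s (z : Z) : Z := of_wbits (fun k => wbit z k (+) (k == s)).

Lemma wbit_flip s z k : k < n.*2 -> wbit (flip s z) k = wbit z k (+) (k == s).
Proof. by move=> kn; rewrite wbit_of_wbits. Qed.

Lemma flipK s : involutive (flip s).
Proof.
move=> z; apply: eq_wbit => j jn; rewrite !wbit_flip //.
by rewrite -addbA addbb addbF.
Qed.

Lemma flip1 s z : odd s -> (flip s z).1 = z.1.
Proof.
move=> os; apply/val_inj.
have s' (x : A) : x %% 2 ^ n = x by rewrite modn_small // -{2}core_modulus.
rewrite -[LHS]s' -[RHS]s'; apply: eq_modn_bits => i ik.
have := @wbit_flip s z i.*2; rewrite /wbit odd_double doubleK => -> //.
  by case: eqP => [E|]; [move: os; rewrite -E odd_double | rewrite addbF].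
by lia.
Qed.

End CoreBits.

(** * The tower over the core *)

Section Sums.
Local Open Scope ring_scope.
Variable R : realFieldType.

Lemma weighted_cauchy (I : finType) (P : pred I) (x w : I -> R) :
  (forall i, P i -> 0 < w i) ->
  (\sum_(i | P i) x i) ^+ 2 <= (\sum_(i | P i) w i) * \sum_(i | P i) x i ^+ 2 / w i.
Proof.
move=> w0; rewrite expr2 -(ler_pM2l (ltr0n R 2 : 0 < 2%:R)).
pose B := \sum_(i | P i) \sum_(j | P j) (w i * (x j ^+ 2 / w j) + w j * (x i ^+ 2 / w i)).
have -> : 2%:R * ((\sum_(i | P i) w i) * \sum_(i | P i) x i ^+ 2 / w i) = B.
  rewrite mulr_natl mulr2n /B; under [RHS]eq_bigr => i _ do rewrite big_split /=.
  rewrite big_split /=; congr (_ + _); rewrite mulr_suml.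
    by apply: eq_bigr => i _; rewrite mulr_sumr.
  rewrite exchange_big /=; apply: eq_bigr => i _; rewrite mulr_sumr; apply: eq_bigr => j _.
  by [].
rewrite mulr_suml mulr_sumr; apply: ler_sum => i Pi.
rewrite !mulr_sumr; apply: ler_sum => j Pj.
have wi := w0 i Pi; have wj := w0 j Pj.
have -> : w i * (x j ^+ 2 / w j) + w j * (x i ^+ 2 / w i) =
  ((w i * x j) ^+ 2 + (w j * x i) ^+ 2) / (w i * w j).
  by field; rewrite !gt_eqF.
rewrite ler_pdivlMr ?mulr_gt0 //.
by have := sqr_ge0 (w i * x j - w j * x i); lra.
Qed.

Lemma cauchy_sum (I : finType) (x : I -> R) :
  (\sum_i x i) ^+ 2 <= #|I|%:R * \sum_i x i ^+ 2.
Proof.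
apply: le_trans (weighted_cauchy (P := xpredT) (w := fun=> 1) x _) _ => [i _|].
  exact: ltr01.
by rewrite sumr_const; under eq_bigr => i _ do rewrite divr1.
Qed.

End Sums.

Section ModSums.
Local Open Scope ring_scope.

Lemma sum_modn (V : nmodType) (F : nat -> V) c d :
  \sum_(0 <= x < c * d) F (x %% d)%N = (\sum_(0 <= x < d) F x) *+ c.
Proof.
elim: c => [|c IH]; first by rewrite mul0n big_nil mulr0n.
rewrite mulSnr (big_cat_nat (n := (c * d)%N)) ?leq_addr //= IH mulrSr; congr (_ + _).
rewrite -{1}[(c * d)%N]add0n big_addn addKn; apply: eq_big_nat => x /andP[_ xd].
by rewrite addnC modnMDl modn_small.
Qed.

Lemma sum_ord_fst (V : nmodType) (F : nat -> V) q :
  \sum_(z : 'I_q * 'I_q) F z.1 = (\sum_(0 <= a < q) F a) *+ q.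
Proof.
rewrite -(pair_bigA _ (fun a b : 'I_q => F a)) /= big_mkord -sumrMnl.
by apply: eq_bigr => a _; rewrite sumr_const card_ord.
Qed.

End ModSums.

Section Tower.
Local Open Scope ring_scope.
Local Open Scope complex_scope.
Variables (R : rcfType) (i0 n : nat).
Hypotheses (i0_ge3 : (3 <= i0)%N) (i0_lt : (i0 < n)%N).

Definition core := ('I_(2 ^ n).-1.+1 * 'I_(2 ^ n).-1.+1)%type.
HB.instance Definition _ := FinRing.Zmodule.on core.

(* The digit [k] lives in [Z/2^(digit_exp k)]; the lowest [2 * i0] digits are
   trivial. *)
Definition digit_exp k := if (k < i0.*2)%N then 0%N else (k./2.-1).*2.
Definition max_digit k := (2 ^ digit_exp k).-1.
Definition half_scale k := (2 ^ k./2.-1)%N.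
Local Notation Z := core.
Local Notation U := (digits n.*2 max_digit).

Definition sigma : bool * bool -> Z -> Z := affine_gen (inZp 1).

Definition digit_root k : R[i] := root2 R (digit_exp k).
Definition chi : U -> U -> R[i] := digit_pair digit_root.

Lemma max_digitS k : (max_digit k).+1 = (2 ^ digit_exp k)%N.
Proof. by rewrite /max_digit prednK ?expn_gt0. Qed.

Lemma digit_root_prim k : (max_digit k).+1.-primitive_root (digit_root k).
Proof. by rewrite max_digitS; apply: root2_prim. Qed.

Lemma chi_pairing : pairing chi.
Proof. by apply: digit_pairP => k; [apply: digit_root_prim | apply: cnorm_root2]. Qed.

Lemma sigma_gap : spectral_gap sigma (1 / 4000%:R : R).
Proof.
have pr : (2 ^ n).-1.+1.-primitive_root (root2 R n) by rewrite core_modulus; apply: root2_prim.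
apply: (affine_gap (cyc_pairP pr (cnorm_root2 R n))) => x.
exact: cyc_pair1.
Qed.

(* Makes [2 u_k + w_k] change by [w_k (+) w_k'], never by [-1], when [sigma]
   moves the bit [w_k] to [w_k']. *)
Definition bit_drop j (z : Z) : U := [ffun k : 'I_n.*2 => inZp (wbit z k && ~~ wbit (sigma j z) k)].

(** The bit [sw k] switches the translation of the digit [k] on or off. In both uses below the
    switches of nontrivial digits belong to the second coordinate, so flipping one does not alter
    the amounts, and restricting to the parity [p] gives distinct moving digits distinct
    switches. *)
Definition shift_digits (sw : nat -> nat) (c : nat -> nat -> nat) p (z : Z) : U :=
  [ffun k : 'I_n.*2 => inZp ((odd k == p) * wbit z (sw k) * c k z.1)].

Definition low_shift := shift_digits (fun k => (k./2).*2.-1) (fun k x => x %% 2 ^ k./2)%N.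
(** With [i = k./2] the amounts are the multiples of [2 ^ (i - 1)] in a group of order
    [2 ^ (2 i - 2)], for nontrivial digits. Amount and switch use only bits before the position
    [k.-1], which receives the overflow. *)
Definition high_shift :=
  shift_digits (fun k => (k./2).*2 - 3)%N (fun k x => x %% 2 ^ k./2.-1 * half_scale k)%N.

(** From this threshold on, a geometric sum of [2 * half_scale k] terms cancels by half; below it a
    component other than 1 has no order dividing [half_scale k], by [unity_root_dist]. *)
Definition low : pred U :=
  fun l => [forall k : 'I_n.*2, (half_scale k)%:R * cnorm (chi l (unit_digit max_digit k) - 1) < 2%:R].

Lemma digit_base (k : 'I_n.*2) (x y : 'I_(max_digit k).+1) : (k < i0.*2)%N -> x = y.
Proof.
move=> ki; have E : (max_digit k).+1 = 1%N by rewrite max_digitS /digit_exp ki.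
have x0 (t : 'I_(max_digit k).+1) : t = 0%N :> nat.
  by apply/eqP; rewrite -leqn0 -ltnS -[X in (_ < X)%N]E ltn_ord.
by apply/val_inj; rewrite /= !x0.
Qed.

Section Switch.
Variables (sw : nat -> nat) (c : nat -> nat -> nat) (k0 : 'I_n.*2) (l : U).
Hypotheses (sw_odd : odd (sw k0)) (sw_lt : (sw k0 < n.*2)%N).
Hypothesis sw_inj : forall k : 'I_n.*2,
  (i0.*2 <= k)%N -> odd k = odd k0 -> sw k = sw k0 -> k = k0.
Hypothesis sw_ok : forall k : 'I_n.*2, (i0.*2 <= k)%N -> (sw k < n.*2)%N.
Let p := odd k0.
Let zeta := chi l (unit_digit max_digit k0).
Let S := \sum_(z : Z) chi l (shift_digits sw c p z).

Let shift_flip z : ~~ wbit z (sw k0) ->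
  shift_digits sw c p (flip (sw k0) z) = shift_digits sw c p z + unit_digit max_digit k0 *+ c k0 z.1.
Proof.
move=> wz; apply/ffunP => k; rewrite digit_addE digit_muln !ffunE flip1 //.
have [->|kk0] := eqVneq k k0.
  rewrite Zp_muln1 wbit_flip // eqxx addbT wz /p eqxx (negPf wz) !mul1n !mul0n.
  by rewrite -[X in X + _]/(inZp 0) (_ : inZp 0 = 0) ?add0r //; apply/val_inj; rewrite /= mod0n.
rewrite mul0rn addr0; have [ki|ki] := ltnP k i0.*2; first exact: digit_base.
rewrite wbit_flip ?sw_ok //; have [ok|//] := eqVneq (odd k) p.
have -> : (sw k == sw k0) = false; last by rewrite addbF.
by apply/negP => /eqP/(sw_inj ki ok)/eqP; rewrite (negPf kk0).
Qed.

Let term_le z : cnorm (chi l (shift_digits sw c p z) + chi l (shift_digits sw c p (flip (sw k0) z)))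
   = cnorm (1 + zeta ^+ c k0 z.1).
Proof.
have P := chi_pairing.
have main y : ~~ wbit y (sw k0) ->
    cnorm (chi l (shift_digits sw c p y) + chi l (shift_digits sw c p (flip (sw k0) y)))
     = cnorm (1 + zeta ^+ c k0 y.1).
  move=> wy; rewrite shift_flip // (pairDr P) (pairMn P) -[X in X + _]mulr1 -mulrDr cnormM.
  by rewrite (cnorm_pair P) mul1r.
have [wz|wz] := boolP (wbit z (sw k0)); last exact: main.
have := main (flip (sw k0) z); rewrite flipK addrC flip1 //; apply.
by rewrite wbit_flip // eqxx addbT wz.
Qed.

(** Flipping the switch of [k0] changes no other digit of the shift, so points pair up with sums of
    modulus [|1 + zeta ^+ c|]; Cauchy-Schwarz then leaves only the sum of the powers of [zeta]. *)
Lemma switch_sum (theta : R) :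
  cnorm (\sum_(z : Z) zeta ^+ c k0 z.1) <= theta * #|{: Z}|%:R ->
  4%:R * nsq S <= (2%:R + 2%:R * theta) * #|{: Z}|%:R ^+ 2.
Proof.
move=> ht; have S2 : cnorm (2%:R * S) <= \sum_(z : Z) cnorm (1 + zeta ^+ c k0 z.1).
  have -> : 2%:R * S = \sum_(z : Z) (chi l (shift_digits sw c p z) +
      chi l (shift_digits sw c p (flip (sw k0) z))).
    rewrite big_split /= mulr_natl mulr2n; congr (_ + _).
    exact/reindex_inj/inv_inj/flipK.
  apply: le_trans (cnorm_sum _ _ _) _; apply: ler_sum => z _.
  by rewrite term_le.
have -> : 4%:R * nsq S = cnorm (2%:R * S) ^+ 2.
  rewrite cnormM cnorm_nat exprMn cnorm_sqr; ring.
apply: le_trans (_ : (\sum_(z : Z) cnorm (1 + zeta ^+ c k0 z.1)) ^+ 2 <= _).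
  by rewrite ler_pXn2r ?nnegrE ?cnorm_ge0 ?sumr_ge0 // => *; apply: cnorm_ge0.
apply: le_trans (cauchy_sum _) _.
rewrite [_ ^+ 2]expr2 mulrCA ler_wpM2l ?ler0n //.
have z1 z : nsq (zeta ^+ c k0 z) = 1 by rewrite nsqX (nsq_pair chi_pairing) expr1n.
under eq_bigr => z _ do rewrite cnorm_sqr nsq1D ?z1 //.
rewrite big_split /= sumr_const -mulr_sumr -Re_sum -[2%:R *+ _]mulr_natr.
by have h := le_trans (Re_le_cnorm _) ht; lra.
Qed.

End Switch.

Lemma card_core : #|{: Z}| = (2 ^ n * 2 ^ n)%N.
Proof. by rewrite card_prod card_ord core_modulus. Qed.

Lemma core_sum_modn (F : nat -> R[i]) j : (j <= n)%N ->
  \sum_(z : Z) F (z.1 %% 2 ^ j)%N = (\sum_(0 <= x < 2 ^ j) F x) *+ (2 ^ (n - j) * 2 ^ n).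
Proof.
move=> jn; rewrite (sum_ord_fst (fun a => F (a %% 2 ^ j)%N)) core_modulus mulrnA.
by rewrite -{1}(subnK jn) expnD sum_modn.
Qed.

Lemma cnorm_mulrn (x : R[i]) k : cnorm (x *+ k) = k%:R * cnorm x.
Proof. by rewrite -[x *+ k]mulr_natl cnormM cnorm_nat. Qed.

Lemma half_ge (k : 'I_n.*2) : (i0.*2 <= k)%N -> (3 <= k./2 < n)%N.
Proof. by have := ltn_ord k; lia. Qed.

Lemma unit_pair_base (l : U) (k : 'I_n.*2) : (k < i0.*2)%N -> chi l (unit_digit max_digit k) = 1.
Proof.
move=> ki; rewrite /chi (digit_pair_unit digit_root_prim); last by move=> j; apply: cnorm_root2.
by rewrite /digit_root /digit_exp ki expr1n.
Qed.

Lemma cnorm_le_of_nsq (x : R[i]) (a : R) : 0 <= a -> nsq x <= a ^+ 2 -> cnorm x <= a.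
Proof.
by move=> a0; rewrite -cnorm_sqr ler_pXn2r ?nnegrE ?cnorm_ge0.
Qed.

Lemma low_shift_kills_high l : ~~ low l ->
  exists p, cnorm (\sum_z chi l (low_shift p z)) <= (7%:R / 8%:R) * #|{: Z}|%:R.
Proof.
move=> /forallPn[k0]; rewrite -leNgt => hk.
set zeta := chi l _ in hk.
have k0_ge : (i0.*2 <= k0)%N.
  rewrite leqNgt; apply/negP => ki; move: hk.
  by rewrite /zeta unit_pair_base // subrr cnorm0 mulr0 lern0.
have /andP[i3 i_n] := half_ge k0_ge.
exists (odd k0); have NZ0 : 0 <= #|{: Z}|%:R :> R by rewrite ler0n.
apply: cnorm_le_of_nsq; first by rewrite mulr_ge0 // divr_ge0 ?ler0n.
have z1 : cnorm zeta = 1 by apply: (cnorm_pair chi_pairing).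
have := @switch_sum (fun k => (k./2).*2.-1) (fun k x => x %% 2 ^ k./2)%N k0 l.
move=> /(_ ltac:(lia) ltac:(lia) ltac:(move=> k ki ok sk; apply: val_inj => /=; lia)
  ltac:(move=> k ki; have := ltn_ord k; lia) (1 / 2%:R)) sw.
(* With [theta = 1 / 2] the switch estimate is sufficient because [3 / 4 <= (7 / 8) ^ 2]. *)
suff /sw : cnorm (\sum_(z : Z) zeta ^+ (z.1 %% 2 ^ k0./2)) <= 1 / 2%:R * #|{: Z}|%:R.
  rewrite -/(low_shift _) => h; have := sqr_ge0 (#|{: Z}|%:R : R).
  by rewrite exprMn; lra.
rewrite (core_sum_modn (fun x => zeta ^+ x)) ?(ltnW i_n) // cnorm_mulrn.
have geo : cnorm (\sum_(0 <= x < 2 ^ k0./2) zeta ^+ x) <= (half_scale k0)%:R.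
  have zn0 : 0 < cnorm (zeta - 1).
    rewrite lt_def cnorm_ge0 andbT; apply: contraTneq hk => ->.
    by rewrite mulr0 -ltNge ltr0n.
  rewrite -(ler_pM2l zn0) -cnormM big_mkord -subrX1 mulrC.
  apply: le_trans hk; apply: le_trans (cnormD _ _) _.
  by rewrite cnormN cnorm1 cnormX z1 expr1n lexx.
apply: le_trans (ler_wpM2l (ler0n _ _) geo) _.
rewrite card_core -natrM.
have -> : (2 ^ n * 2 ^ n = 2 * (2 ^ (n - k0./2) * 2 ^ n * half_scale k0))%N.
  rewrite /half_scale -!expnD -expnS; congr (_ ^ _)%N; lia.
by rewrite [in leRHS]natrM div1r mulKf ?pnatr_eq0.
Qed.

Lemma high_shift_kills_low l : low l -> l != 0 ->
  exists p, cnorm (\sum_z chi l (high_shift p z)) <= (3%:R / 4%:R) * #|{: Z}|%:R.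
Proof.
move=> /forallP lowl l0.
have [k0 zn1] : exists k0 : 'I_n.*2, chi l (unit_digit max_digit k0) != 1.
  apply/existsP; apply: contraNT l0 => /existsPn h; apply/eqP.
  have e1 u : chi l u = 1.
    rewrite /chi (digit_pairE digit_root_prim); last by move=> j; apply: cnorm_root2.
    by rewrite big1 // => k _; have /eqP := negbNE (h k); rewrite /chi => ->; rewrite expr1n.
  apply/eqP; rewrite -[_ == _]negbK; apply/negP => /(pair_nz chi_pairing)[y].
  by rewrite e1 eqxx.
have := lowl k0; set zeta := chi l _ in zn1 * => hk.
have k0_ge : (i0.*2 <= k0)%N.
  by rewrite leqNgt; apply/negP => ki; move: zn1; rewrite /zeta unit_pair_base // eqxx.
have /andP[i3 i_n] := half_ge k0_ge.
exists (odd k0); have NZ0 : 0 <= #|{: Z}|%:R :> R by rewrite ler0n.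
apply: cnorm_le_of_nsq; first by rewrite mulr_ge0 // divr_ge0 ?ler0n.
have z1 : cnorm zeta = 1 by apply: (cnorm_pair chi_pairing).
have := @switch_sum (fun k => (k./2).*2 - 3)%N (fun k x => x %% 2 ^ k./2.-1 * half_scale k)%N k0 l.
move=> /(_ ltac:(lia) ltac:(lia) ltac:(move=> k ki ok sk; apply: val_inj => /=; lia)
  ltac:(move=> k ki; have := ltn_ord k; lia) 0) sw.
(* With [theta = 0] it is sufficient because [1 / 2 <= (3 / 4) ^ 2]. *)
suff /sw : cnorm (\sum_(z : Z) zeta ^+ (z.1 %% 2 ^ k0./2.-1 * half_scale k0)) <= 0 * #|{: Z}|%:R.
  rewrite -/(high_shift _) => h; have := sqr_ge0 (#|{: Z}|%:R : R).
  by rewrite exprMn; lra.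
rewrite mul0r; under eq_bigr => z _ do rewrite mulnC exprM.
rewrite (core_sum_modn (fun x => (zeta ^+ half_scale k0) ^+ x)); last by lia.
suff -> : \sum_(0 <= x < 2 ^ k0./2.-1) (zeta ^+ half_scale k0) ^+ x = 0 by rewrite mul0rn cnorm0.
have zm1 : zeta ^+ half_scale k0 != 1.
  apply/negP => /eqP zm1; have := unity_root_dist (expn_gt0 2 _) z1 zm1 zn1.
  by rewrite leNgt hk.
apply: (mulfI (x := zeta ^+ half_scale k0 - 1)); first by rewrite subr_eq0.
(* The order of [zeta] divides [2 ^ digit_exp k0], the square of [half_scale k0], so the complete
   geometric sum vanishes. *)
rewrite mulr0 big_mkord -subrX1 -exprM -expnD.
have -> : (k0./2.-1 + k0./2.-1 = digit_exp k0)%N by rewrite /digit_exp ltnNge k0_ge /= addnn.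
rewrite /zeta /chi (digit_pair_unit digit_root_prim); last by move=> j; apply: cnorm_root2.
by rewrite -exprM mulnC exprM -max_digitS (prim_expr_order (digit_root_prim k0)) expr1n subrr.
Qed.

(** Bounds the total phase that a low character gains when every digit moves by at most 1. The same
    sum bounds the density of the points where a digit may wrap around. *)
Definition rho : R := \sum_(k : 'I_n.*2 | (i0.*2 <= k)%N) 2%:R / (half_scale k)%:R.

Lemma half_scale_gt0 k : 0 < (half_scale k)%:R :> R.
Proof. by rewrite ltr0n expn_gt0. Qed.

Lemma rho_ge0 : 0 <= rho.
Proof. by apply: sumr_ge0 => k _; rewrite divr_ge0 ?ler0n. Qed.

Lemma low_unit l (k : 'I_n.*2) : low l ->
  cnorm (chi l (unit_digit max_digit k) - 1) <= 2%:R / (half_scale k)%:R.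
Proof. by move/forallP/(_ k) => h; rewrite ler_pdivlMr ?half_scale_gt0 // mulrC ltW. Qed.

Lemma low_small l (u : U) : low l -> (forall k, (u k <= 1)%N) ->
  cnorm (chi l u - 1) <= rho.
Proof.
move=> lowl u1; rewrite /chi (digit_pairE digit_root_prim); last by move=> j; apply: cnorm_root2.
apply: le_trans (cnorm_prodB1 _ _) _ => [k|].
  by rewrite cnormX -/chi (cnorm_pair chi_pairing) expr1n.
rewrite /rho [leRHS]big_mkcond; apply: ler_sum => k _; rewrite -/chi.
case: ifPn => [ki|]; last first.
  by rewrite -ltnNge => ki; rewrite unit_pair_base // expr1n subrr cnorm0.
have := u1 k; case: (nat_of_ord (u k)) => [|[|//]] _.
  by rewrite expr0 subrr cnorm0 divr_ge0 ?ler0n.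
by rewrite expr1; apply: low_unit.
Qed.

Lemma bit_drop_flat l j z : low l -> nsq (chi l (bit_drop j z) - 1) <= rho ^+ 2.
Proof.
move=> lowl; rewrite -cnorm_sqr ler_pXn2r ?nnegrE ?cnorm_ge0 ?rho_ge0 //.
apply: low_small => // k; rewrite ffunE /=; apply: leq_trans (leq_mod _ _) _.
by case: (_ && _).
Qed.

Lemma shift_low (G : U -> R[i]) (k : 'I_n.*2) :
  (forall l, ~~ low l -> fourier chi G l = 0) ->
  \sum_u nsq (G (u + unit_digit max_digit k) - G u) <= (2%:R / (half_scale k)%:R) ^+ 2 * \sum_u nsq (G u).
Proof.
move=> hG; have NU : 0 < #|{: U}|%:R :> R by rewrite ltr0n card_digits_gt0.
rewrite -(ler_pM2l NU) mulrCA -!(parseval chi_pairing) mulr_sumr.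
apply: ler_sum => l _; rewrite fourierB (fourier_shift chi_pairing).
rewrite -[X in _ - X]mul1r -mulrBl nsqM.
have [lowl|/hG->] := boolP (low l); last by rewrite nsq0 !mulr0.
rewrite ler_wpM2r ?nsq_ge0 // -cnorm_sqr ler_pXn2r ?nnegrE ?cnorm_ge0 ?divr_ge0 ?ler0n //.
exact: low_unit.
Qed.

Definition digit_nat (u : U) (k : nat) : nat := if insub k is Some i then u i : nat else 0%N.

Lemma digit_natE u (k : 'I_n.*2) : digit_nat u k = u k.
Proof. by rewrite /digit_nat valK. Qed.

(** Overflows are read from digits of parity [p] and received by the others. The condition
    [i0.*2 <= k] drops the overflow of the digit [i0.*2], whose more significant neighbour is
    trivial. *)
Definition carry p (z : Z) (u : U) (k : nat) : bool :=
  [&& (i0.*2 <= k)%N, odd k != p, (k.+1 < n.*2)%N &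
      (2 ^ digit_exp k.+1 <= digit_nat u k.+1 + digit_nat (high_shift p z) k.+1)%N].

Definition carry_vec p (z : Z) (u : U) : U :=
  [ffun k : 'I_n.*2 => inZp (carry p z u k && wbit z k)].

(* The overflow of the digit [k] is passed to the digit [k.-1], which is more
   significant for [rank]: it flips the bit [k.-1] and then carries into
   [u_(k.-1)]. *)
Definition carry_map p (x : Z * U) : Z * U :=
  (of_wbits n (fun k => wbit x.1 k (+) carry p x.1 x.2 k),
   x.2 + high_shift p x.1 + carry_vec p x.1 x.2).

Lemma eq_carry p z (u v : U) k :
  (forall j : 'I_n.*2, odd j = p -> u j = v j) -> carry p z u k = carry p z v k.
Proof.
move=> uv; rewrite /carry; case: (i0.*2 <= k)%N => //=.
have [//|ok /=] := eqVneq (odd k) p; case: (ltnP k.+1 n.*2) => //= kn.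
have ok' : odd (Ordinal kn) = p by move: ok; rewrite /=; case: (odd k); case: (p).
by rewrite -[k.+1]/(val (Ordinal kn)) !digit_natE uv.
Qed.

Lemma carry_vec_par p z u (j : 'I_n.*2) : odd j = p -> carry_vec p z u j = 0.
Proof.
move=> oj; rewrite ffunE /carry oj eqxx andbF /=.
by apply/val_inj; rewrite /= mod0n.
Qed.

Let partial p z u (m : nat) : U :=
  \sum_(k : 'I_n.*2 | (k < m)%N && (carry p z u k && wbit z k)) unit_digit max_digit k.

Let partialE p z u m (j : 'I_n.*2) :
  partial p z u m j = if (j < m)%N && (carry p z u j && wbit z j) then inZp 1 else 0.
Proof.
rewrite /partial digit_sum; case: ifPn => hj.
  rewrite (bigD1 j) //= big1 ?addr0 ?ffunE ?eqxx // => i /andP[_ ij].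
  by rewrite ffunE eq_sym (negPf ij).
apply: big1 => i hi; rewrite ffunE; case: eqP => // E.
by move: hj; rewrite E hi.
Qed.

Let partial_full p z u : partial p z u n.*2 = carry_vec p z u.
Proof.
apply/ffunP => j; rewrite partialE ltn_ord /= ffunE; case: ifP => // _.
by apply/val_inj; rewrite /= mod0n.
Qed.

(** The carries depend only on digits of parity [p], which they leave alone, so they can be
    recovered and subtracted. *)
Let partial_inj p z m (v : U) : injective (fun u : U => u + v + partial p z u m).
Proof.
move=> u u' E; have uu j : odd (j : 'I_n.*2) = p -> u j = u' j.
  move=> oj; have /ffunP/(_ j) := E; rewrite !digit_addE !partialE /carry oj eqxx.
  by rewrite /= !andbF !addr0 => /addIr.
have EP : partial p z u m = partial p z u' m.
  by apply: eq_bigl => k; rewrite (eq_carry z k uu).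
by move: E; rewrite EP => /addIr/addIr.
Qed.

(** Telescoping over the digits: after a bijection of [U] each step is a translation by one unit
    digit, bounded by [shift_low]. Cauchy-Schwarz, weighted by the square roots of these bounds,
    sums them to [rho ^+ 2]. *)
Lemma carry_small p z (G : U -> R[i]) :
  (forall l, ~~ low l -> fourier chi G l = 0) ->
  \sum_u nsq (G (u + high_shift p z + carry_vec p z u) - G (u + high_shift p z)) <=
  rho ^+ 2 * \sum_u nsq (G u).
Proof.
move=> hG; pose c u (k : 'I_n.*2) := carry p z u k && wbit z k.
pose X u m := u + high_shift p z + partial p z u m.
pose D u (k : 'I_n.*2) := if c u k then G (X u k + unit_digit max_digit k) - G (X u k) else 0.
have step u (k : 'I_n.*2) : G (X u k.+1) - G (X u k) = D u k.
  have -> : X u k.+1 = X u k + (if c u k then unit_digit max_digit k else 0).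
    rewrite /X -[RHS]addrA; congr (_ + _); apply/ffunP => j.
    rewrite digit_addE !partialE ltnS leq_eqVlt.
    have [/val_inj->|jk] := eqVneq (j : nat) k.
      rewrite ltnn /= -/(c u k); case: ifP => // ck.
        by rewrite ffunE eqxx add0r.
      by rewrite ffunE addr0.
    rewrite /=; case: (c u k); rewrite ?digit0E ?addr0 //.
    by rewrite ffunE -val_eqE (negPf jk) addr0.
  by rewrite /D; case: (c u k); rewrite ?addr0 ?subrr.
have tele u : G (u + high_shift p z + carry_vec p z u) - G (u + high_shift p z) =
    \sum_(k : 'I_n.*2 | (i0.*2 <= k)%N) D u k.
  have -> : G (u + high_shift p z + carry_vec p z u) = G (X u n.*2) by rewrite /X partial_full.
  have -> : G (u + high_shift p z) = G (X u 0%N).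
    by rewrite /X /partial big_pred0 ?addr0 // => k; rewrite ltn0.
  rewrite -(telescope_sumr (fun m => G (X u m)) (leq0n _)) big_mkord [RHS]big_mkcond; apply: eq_bigr => k _.
  rewrite step; case: ifPn => // ki.
  by rewrite /D /c /carry (negPf ki).
have w0 (k : 'I_n.*2) : 0 < 2%:R / (half_scale k)%:R :> R by rewrite divr_gt0 ?half_scale_gt0 ?ltr0n.
apply: le_trans (_ : \sum_u rho * \sum_(k : 'I_n.*2 | (i0.*2 <= k)%N)
    (nsq (D u k) / (2%:R / (half_scale k)%:R)) <= _).
  apply: ler_sum => u _; rewrite tele -cnorm_sqr.
  apply: le_trans (_ : (\sum_(k : 'I_n.*2 | (i0.*2 <= k)%N) cnorm (D u k)) ^+ 2 <= _).
    rewrite ler_pXn2r ?nnegrE ?cnorm_ge0 ?cnorm_sum //.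
    by apply: sumr_ge0 => *; apply: cnorm_ge0.
  apply: le_trans (weighted_cauchy _ (fun k _ => w0 k)) _.
  by under [X in _ * X <= _]eq_bigr => k _ do rewrite cnorm_sqr.
rewrite -mulr_sumr expr2 -mulrA ler_wpM2l ?rho_ge0 // exchange_big /rho mulr_suml /=.
apply: ler_sum => k _; rewrite -mulr_suml ler_pdivrMr // mulrAC -expr2.
apply: le_trans (shift_low k hG).
rewrite [leRHS](reindex_inj (@partial_inj p z k (high_shift p z))) /=; apply: ler_sum => u _.
by rewrite /D; case: (c u k) => //; rewrite nsq0 nsq_ge0.
Qed.

Lemma carry_map_near_shift p (G : U -> R[i]) :
  (forall l, ~~ low l -> fourier chi G l = 0) ->
  \sum_x nsq (G (carry_map p x).2 - G (x.2 + high_shift p x.1)) <=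
  rho ^+ 2 * #|{: Z}|%:R * \sum_u nsq (G u).
Proof.
move=> hG; rewrite -(pair_bigA _ (fun z u => nsq (G (carry_map p (z, u)).2 - G (u + high_shift p z)))) /=.
rewrite -mulrA mulrCA mulr_natl -sumr_const; apply: ler_sum => z _.
exact: carry_small.
Qed.

End Tower.

(** * Spectral gap of the eight tower maps *)

Section TowerGap.
Local Open Scope ring_scope.
Local Open Scope complex_scope.
Variables (R : rcfType) (i0 n : nat).
Hypotheses (i0_ge3 : (3 <= i0)%N) (i0_lt : (i0 < n)%N).
Local Notation Z := (core n).
Local Notation U := (digits n.*2 (max_digit i0)).
Local Notation X := (Z * U)%type.

Lemma eq_high_shift p (z z' : Z) (k : 'I_n.*2) :
  (forall j, (j < k.-1)%N -> wbit z j = wbit z' j) -> high_shift i0 p z k = high_shift i0 p z' k.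
Proof.
move=> h; rewrite !ffunE; have [ki|ki] := ltnP k i0.*2; first exact: digit_base.
congr (inZp (_ * _ * (_ * _))); first by rewrite h //; lia.
apply: eq_modn_bits => i ik; have := h i.*2; rewrite /wbit odd_double doubleK.
by apply; lia.
Qed.

(** The bits are recovered from the most significant on: those before [m] determine the translation
    of the digit [m.+1] when it has parity [p], hence that digit and the carry into the bit [m]. *)
Lemma carry_map_inj p : injective (@carry_map i0 n p).
Proof.
move=> [z u] [z' u'] E; pose K := n.*2.
have E1 := congr1 fst E; have E2 := congr1 snd E; rewrite /= in E1 E2.
have wE k : (k < K)%N -> wbit z k (+) carry p z u k = wbit z' k (+) carry p z' u' k.
  by move=> kK; have := congr1 (fun y => wbit y k) E1; rewrite !wbit_of_wbits.
have uE (k : 'I_K) : u k + high_shift i0 p z k + carry_vec p z u k =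
    u' k + high_shift i0 p z' k + carry_vec p z' u' k.
  by have /ffunP/(_ k) := E2; rewrite !digit_addE.
have upE (k : 'I_K) : odd k = p -> (forall j, (j < k.-1)%N -> wbit z j = wbit z' j) -> u k = u' k.
  move=> ok h; have := uE k; rewrite !carry_vec_par // (eq_high_shift p h).
  by move=> /addIr/addIr.
have main m : (forall k, (k < m)%N -> (k < K)%N -> wbit z k = wbit z' k).
  elim: m => [//|m IH] k; rewrite ltnS leq_eqVlt => /orP[/eqP->|]; last exact: IH.
  move=> mK; have := wE m mK; suff -> : carry p z u m = carry p z' u' m.
    by apply: addIb.
  rewrite /carry; case: (_ <= m)%N => //=; have [//|digit_root /=] := eqVneq (odd m) p.
  case: ltnP => //= m1K; rewrite -[m.+1]/(val (Ordinal m1K)) !digit_natE.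
  have ok' : odd (Ordinal m1K) = p by move: digit_root; rewrite /=; case: (odd m); case: (p).
  have h j : (j < (Ordinal m1K).-1)%N -> wbit z j = wbit z' j.
    by move=> /= jm; apply: IH => //; apply: ltn_trans mK.
  by rewrite (upE _ ok' h) (eq_high_shift p h).
have zE : z = z' by apply: eq_wbit => j jK; apply: (main K).
subst z'; congr (_, _); apply/ffunP => k.
have par (j : 'I_K) : odd j = p -> u j = u' j by move=> oj; apply: upE.
have cE : carry_vec p z u = carry_vec p z u'.
  by apply/ffunP => j; rewrite !ffunE (eq_carry z j par).
by have := uE k; rewrite cE => /addIr/addIr.
Qed.

Lemma rho_le : rho R i0 n <= 16%:R / (2 ^ i0)%:R.
Proof.
rewrite /rho -(big_mkord (fun k => i0.*2 <= k)%N (fun k => 2%:R / (half_scale k)%:R)).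
(* The subtracted term makes the induction close: the two digits [k] with [k./2 = N] contribute
   [8 / 2 ^ N] together. *)
suff H N : (i0 <= N)%N -> \sum_(0 <= k < N.*2 | (i0.*2 <= k)%N) 2%:R / (half_scale k)%:R <=
    16%:R / (2 ^ i0)%:R - 16%:R / (2 ^ N)%:R :> R.
  apply: le_trans (H n (ltnW i0_lt)) _.
  by rewrite gerBl divr_ge0 ?ler0n.
elim: N => [|N IH]; first by lia.
rewrite leq_eqVlt => /orP[/eqP <-|].
  rewrite subrr big_nat_cond big_pred0 // => k; lia.
rewrite ltnS => iN; rewrite doubleS !big_mkcond big_nat_recr //= big_nat_recr //=.
rewrite -big_mkcond leq_double iN (leq_trans _ (leqnSn _)) ?leq_double //.
rewrite /half_scale /= uphalf_double doubleK.
have -> : 2%:R / (2 ^ N.-1)%:R = 4%:R / (2 ^ N)%:R :> R.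
  have N0 : (0 < N)%N by lia.
  rewrite -[in RHS](prednK N0) expnS natrM; field.
  by rewrite !pnatr_eq0 expn_eq0.
apply: le_trans (lerD (lerD (IH iN) (lexx _)) (lexx _)) _.
have -> : 16%:R / (2 ^ N.+1)%:R = 8%:R / (2 ^ N)%:R :> R.
  rewrite expnS natrM; field.
  by rewrite pnatr_eq0 expn_eq0.
lra.
Qed.

Definition tower_map (m : (bool * bool) + (bool + bool)) (x : X) : X :=
  match m with
  | inl j => (sigma j x.1, x.2 + bit_drop i0 j x.1)
  | inr (inl p) => (x.1, x.2 + low_shift i0 p x.1)
  | inr (inr p) => carry_map p x
  end.

Lemma sigma_inj j : injective (@sigma n j).
Proof. exact: affine_gen_inj. Qed.

Lemma tower_map_inj m : injective (tower_map m).
Proof.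
case: m => [j|[p|p]] [z u] [z' u'] /=; last exact: carry_map_inj.
  by case=> /sigma_inj-> /addIr->.
by case=> -> /addIr->.
Qed.

Lemma sum_set (T : {set X}) : \sum_x ((x \in T)%:R : R) = #|T|%:R.
Proof. by rewrite -sum1_card natr_sum [RHS]big_mkcond; apply: eq_bigr => x _; case: (x \in T). Qed.

(** A bijection moves as many points out of [T] as into it, hence the factor 2. *)
Lemma moved_set (T : {set X}) (M : X -> X) : injective M ->
  \sum_x ((M x \in T)%:R - (x \in T)%:R) ^+ 2 = 2%:R * #|[set x in T | M x \notin T]|%:R :> R.
Proof.
move=> M_inj; rewrite -sum_set.
have E : \sum_x ((M x \in T)%:R : R) = \sum_x (x \in T)%:R.
  by rewrite [RHS](reindex_inj M_inj).
transitivity (\sum_x (((M x \in T)%:R - (x \in T)%:R) +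
    2%:R * ((x \in [set x in T | M x \notin T])%:R : R))).
  by apply: eq_bigr => x _; rewrite inE; case: (M x \in T); case: (x \in T) => /=; ring.
by rewrite big_split /= sumrB E subrr add0r mulr_sumr.
Qed.

Hypothesis rho_small : rho R i0 n <= 1 / 3000%:R.

(** The skew gap is applied to the indicator of [T] minus its density, with [gam = 1 / 4000]; [8000]
    contains the factor 2 of [moved_set]. *)
Lemma tower_gap_real (T : {set X}) :
  #|T|%:R * (#|{: X}|%:R - #|T|%:R) <= (17680%:R * 8000%:R) * #|{: X}|%:R *
    (\sum_m #|[set x in T | tower_map m x \notin T]|%:R) :> R.
Proof.
have NX : 0 < #|{: X}|%:R :> R.
  rewrite card_prod natrM mulr_gt0 ?ltr0n ?card_digits_gt0 //.
  by rewrite card_core muln_gt0 expn_gt0.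
pose c : R := #|T|%:R / #|{: X}|%:R.
have cX : c * #|{: X}|%:R = #|T|%:R by rewrite /c divfK ?gt_eqF.
pose f z u : R[i] := (((z, u) \in T)%:R - c)%:C.
have f0 : \sum_z \sum_u f z u = 0.
  transitivity ((\sum_x ((x \in T)%:R - c))%:C).
    by rewrite pair_bigA rmorph_sum; apply: eq_bigr => -[].
  by rewrite sumrB sum_set sumr_const -[c *+ _]mulr_natr cX subrr rmorph0.
have normf : \sum_z \sum_u nsq (f z u) = #|T|%:R - c * #|T|%:R.
  transitivity (\sum_x ((x \in T)%:R - c) ^+ 2 : R).
    by rewrite pair_bigA; apply: eq_bigr => -[z u] _; rewrite /f nsqR.
  transitivity (\sum_x ((1 - 2%:R * c) * (x \in T)%:R + c ^+ 2 : R)).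
    by apply: eq_bigr => x _; case: (x \in T) => /=; ring.
  have -> : #|T|%:R - c * #|T|%:R = (1 - 2%:R * c) * #|T|%:R + c * (c * #|{: X}|%:R).
    by rewrite cX; ring.
  rewrite big_split /= -mulr_sumr sum_set sumr_const; congr (_ + _).
  by rewrite -[LHS]mulr_natr expr2 mulrA.
have D m : \sum_x nsq (f (tower_map m x).1 (tower_map m x).2 - f x.1 x.2) =
    2%:R * #|[set x in T | tower_map m x \notin T]|%:R.
  rewrite -(moved_set _ (@tower_map_inj m)); apply: eq_bigr => x _.
  by rewrite /f -rmorphB nsqR -!surjective_pairing; congr (_ ^+ 2); ring.
have r0 := rho_ge0 R i0 n.
have r2 : rho R i0 n ^+ 2 <= 1 / 3000%:R * (1 / 3000%:R).
  by rewrite expr2 ler_pM.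
have J4 : #|{: bool * bool}|%:R = 4%:R :> R by rewrite card_prod card_bool.
have g0 : 0 < 1 / 4000%:R :> R by rewrite divr_gt0 ?ltr0n.
have g1 : 1 / 4000%:R <= 1 :> R by rewrite ler_pdivrMr ?ltr0n // mul1r ler1n.
have h32 : rho R i0 n ^+ 2 <= 1 / 32%:R by lra.
have h520 : 520%:R * #|{: bool * bool}|%:R * rho R i0 n ^+ 2 <= 1 / 4000%:R by rewrite J4; lra.
have := skew_gap (chi_pairing R i0 n) g0 g1 sigma_inj (@sigma_gap R n)
  carry_map_inj (low_shift_kills_high i0_ge3 i0_lt) (fun l j z h => bit_drop_flat j z h)
  (high_shift_kills_low i0_ge3 i0_lt) (@carry_map_near_shift R i0 n) (sqr_ge0 _) h32 h520 f0.
rewrite normf /= (D (inr (inr true))) (D (inr (inr false))).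
have DV p : \sum_z \sum_u nsq (f z (u + low_shift i0 p z) - f z u) =
    2%:R * #|[set x in T | tower_map (inr (inl p)) x \notin T]|%:R.
  by rewrite -D pair_bigA.
have DW j : \sum_z \sum_u nsq (f (sigma j z) (u + bit_drop i0 j z) - f z u) =
    2%:R * #|[set x in T | tower_map (inl j) x \notin T]|%:R.
  by rewrite -D pair_bigA.
rewrite !DV (eq_bigr _ (fun j _ => DW j)) -mulr_sumr.
have -> : \sum_m #|[set x in T | tower_map m x \notin T]|%:R =
  \sum_j #|[set x in T | tower_map (inl j) x \notin T]|%:R +
  (#|[set x in T | tower_map (inr (inl true)) x \notin T]|%:R +
   #|[set x in T | tower_map (inr (inl false)) x \notin T]|%:R) +
  (#|[set x in T | tower_map (inr (inr true)) x \notin T]|%:R +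
   #|[set x in T | tower_map (inr (inr false)) x \notin T]|%:R) :> R.
  by rewrite big_sumType /= big_sumType /= !big_bool [LHS]addrA.
move: (\sum_j _) #|[set x in T | tower_map (inr (inl true)) x \notin T]|%:R
  #|[set x in T | tower_map (inr (inl false)) x \notin T]|%:R
  #|[set x in T | tower_map (inr (inr true)) x \notin T]|%:R
  #|[set x in T | tower_map (inr (inr false)) x \notin T]|%:R => w v1 v2 v3 v4.
have -> : #|T|%:R * (#|{: X}|%:R - #|T|%:R) = #|{: X}|%:R * (#|T|%:R - c * #|T|%:R) :> R.
  by rewrite -[in RHS]cX; ring: cX.
move: (17680%:R) => C h; rewrite -[leRHS]mulrA [leRHS]mulrCA ler_pM2l //.
have -> : C * 8000%:R * (w + (v1 + v2) + (v3 + v4)) =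
    4000%:R * (C * (2%:R * w + (2%:R * v1 + 2%:R * v2) + (2%:R * v3 + 2%:R * v4))) by ring.
by rewrite -ler_pdivrMl ?ltr0n // mulrC -[X in _ * X]div1r mulrC.
Qed.

End TowerGap.

Section TowerGapNat.
Local Open Scope ring_scope.
Variable R : rcfType.

Lemma rho_small_of i0 n : (16 <= i0)%N -> (i0 < n)%N -> rho R i0 n <= 1 / 3000%:R.
Proof.
move=> h16 hn; apply: le_trans (rho_le R (leq_trans _ h16) hn) _ => //.
rewrite ler_pdivrMr ?ltr0n ?expn_gt0 // natrX.
have : 2%:R ^+ 16 <= 2%:R ^+ i0 :> R by rewrite ler_eXn2l ?ltr1n.
have -> : 2%:R ^+ 16 = ((2%:R ^+ 4) ^+ 2) ^+ 2 :> R by rewrite -!exprM.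
have -> : 2%:R ^+ 4 = 16%:R :> R by ring.
lra.
Qed.

(** The constant is chosen before [i0], which is later taken large in terms of it. *)
Lemma tower_gap : exists C : nat, forall i0 n, (16 <= i0)%N -> (i0 < n)%N ->
  forall T : {set core n * digits n.*2 (max_digit i0)},
  (#|T| * (#|{: core n * digits n.*2 (max_digit i0)}| - #|T|) <=
   C * #|{: core n * digits n.*2 (max_digit i0)}| *
     \sum_m #|[set x in T | tower_map m x \notin T]|)%N.
Proof.
exists (17680 * 8000)%N => i0 n h16 hn T.
have i3 : (3 <= i0)%N by apply: leq_trans h16.
have := tower_gap_real i3 hn (rho_small_of h16 hn) T.
by rewrite -natrB ?max_card // -natr_sum -!natrM ler_nat.
Qed.

End TowerGapNat.

(** * Monotonicity with respect to the rank *)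

Lemma divmod_uniq P r d r' d' : d < P -> d' < P ->
  r * P + d = r' * P + d' -> r = r' /\ d = d'.
Proof.
move=> dP dP' E; have P0 : 0 < P by apply: leq_ltn_trans dP.
have := congr1 (divn^~ P) E; rewrite !divnMDl // !divn_small // !addn0 => Er.
by split=> //; move: E; rewrite Er => /addnI.
Qed.

Section MonotoneStep.
Variables (X : Type) (S : pred X) (M : X -> X).

(** Also used for ranks truncated to their leading digits, which are not injective; hence the clause
    on equality. *)
Definition rank_mono (r : X -> nat) := forall x x', S x -> S x' ->
  (r x = r x' -> r (M x) = r (M x')) /\ (r x < r x' -> r (M x) < r (M x')).

(** Points that agree on the leading part have their next digit moved by the same amount [c - d], so
    their order is kept; [d] allows for a wrap-around common to all of them. *)
Lemma rank_mono_step (r y c d : X -> nat) P :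
  rank_mono r -> (forall x, y x < P) ->
  (forall x, S x -> y (M x) + d x = y x + c x) ->
  (forall x x', S x -> S x' -> r x = r x' -> c x = c x' /\ d x = d x') ->
  rank_mono (fun x => r x * P + y x).
Proof.
move=> hr yP hy hc x x' Sx Sx'; have [h1 h2] := hr x x' Sx Sx'.
have := yP x; have := yP x'; have := yP (M x); have := yP (M x').
have := hy x Sx; have := hy x' Sx'; have := hc x x' Sx Sx'.
move: (y x) (y x') (y (M x)) (y (M x')) (r x) (r x') (r (M x)) (r (M x'))
  (c x) (c x') (d x) (d x') h1 h2 => y1 y2 z1 z2 r1 r2 s1 s2 c1 c2 d1 d2 h1 h2 hcd e2 e1 zP2 zP1 yP2 yP1.
have eqr : r1 * P + y1 = r2 * P + y2 -> r1 = r2 by nia.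
have ltr : r1 * P + y1 < r2 * P + y2 -> r1 < r2 \/ r1 = r2 by nia.
split=> [E|lt12].
  have E1 := eqr E; have [? ?] := hcd E1; have := h1 E1; nia.
case: (ltr lt12) => [lt|E1]; first by have := h2 lt; nia.
have [? ?] := hcd E1; have := h1 E1; nia.
Qed.

End MonotoneStep.

Section Rank.
Variables (i0 n : nat).
Hypotheses (i0_ge3 : 3 <= i0) (i0_lt : i0 < n).
Local Notation Z := (core n).
Local Notation U := (digits n.*2 (max_digit i0)).
Local Notation X := (Z * U)%type.
Local Notation exi := (digit_exp i0).
Local Notation dgt := (@digit_nat i0 n).

Definition radix k := 2 * 2 ^ exi k.
Definition digit (x : X) k : nat := 2 * dgt x.2 k + wbit x.1 k.

Fixpoint rank (x : X) m : nat := if m is m'.+1 then rank x m' * radix m' + digit x m' else 0.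

Lemma digit_nat_lt u k : dgt u k < 2 ^ exi k.
Proof.
rewrite /digit_nat; case: insubP => [j _ <-|_]; last by rewrite expn_gt0.
by rewrite -max_digitS ltn_ord.
Qed.

Lemma digit_nat_add (u v : U) k : k < n.*2 -> dgt (u + v)%R k = (dgt u k + dgt v k) %% 2 ^ exi k.
Proof.
move=> kn; rewrite -[k]/(val (Ordinal kn)) !digit_natE digit_addE /=.
by congr (_ %% _); rewrite max_digitS.
Qed.

Lemma digit_nat_ffun (g : nat -> nat) k : k < n.*2 ->
  dgt [ffun j : 'I_n.*2 => inZp (g j)] k = g k %% 2 ^ exi k.
Proof. move=> kn; rewrite -[k]/(val (Ordinal kn)) digit_natE ffunE /=.
by congr (_ %% _); rewrite max_digitS. Qed.

Lemma digit_lt x k : digit x k < radix k.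
Proof.
rewrite /digit /radix; have := digit_nat_lt x.2 k; have := leq_b1 (wbit x.1 k).
by move: (dgt _ _) (2 ^ _) (nat_of_bool _) => a b c; lia.
Qed.

Lemma rank_digit x x' m : rank x m = rank x' m ->
  forall k, k < m -> digit x k = digit x' k.
Proof.
elim: m => // m IH /= E k; rewrite ltnS leq_eqVlt.
have := digit_lt x m; have := digit_lt x' m => d1 d2.
have [E1 E2] := divmod_uniq d2 d1 E.
by move=> /orP[/eqP->|] //; apply: IH.
Qed.

Lemma eq_rank x x' m : (forall k, k < m -> digit x k = digit x' k) -> rank x m = rank x' m.
Proof.
by elim: m => // m IH h /=; rewrite (h m) // IH // => k km; apply: h; apply: leqW.
Qed.

Lemma digit_wbit x x' k : digit x k = digit x' k -> wbit x.1 k = wbit x'.1 k.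
Proof. by rewrite /digit; case: (wbit _ _); case: (wbit _ _) => //; lia. Qed.

Lemma digit_dg x x' k : digit x k = digit x' k -> dgt x.2 k = dgt x'.2 k.
Proof. by rewrite /digit; case: (wbit _ _); case: (wbit _ _) => //; lia. Qed.

Lemma rank_inj : injective (rank^~ n.*2).
Proof.
move=> x x' /rank_digit h; rewrite [x]surjective_pairing [x']surjective_pairing.
congr (_, _); first by apply: eq_wbit => j jn; apply: digit_wbit; apply: h.
apply/ffunP => k; apply/val_inj; rewrite /= -!digit_natE.
by apply: digit_dg; apply: h; apply: ltn_ord.
Qed.

Lemma sigma_triangular j (z z' : Z) k : k < n.*2 ->
  (forall i, i < k -> wbit z i = wbit z' i) ->
  wbit (sigma j z) k (+) wbit z k = wbit (sigma j z') k (+) wbit z' k.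
Proof.
move=> kn hw; have hn : k./2 < n by lia.
have h1 : z.1 = z'.1 %[mod 2 ^ k./2].
  apply: eq_modn_bits => i ik; have := hw i.*2; rewrite /wbit odd_double doubleK.
  by apply; lia.
have [_ h2] := eq_modn_wbit hw.
have hm x : x %% (2 ^ n).-1.+1 = x %% 2 ^ n by rewrite core_modulus.
(* Multiplication by 4 gains two bits; one bit beyond the known ones is enough to determine the bit
   [k./2] of the sum. *)
have e4 (a a' : 'I_(2 ^ n).-1.+1) : a = a' %[mod 2 ^ k./2] ->
    (a *+ 4)%R = (a' *+ 4)%R %[mod 2 ^ k./2.+1].
  have four (b : 'I_(2 ^ n).-1.+1) : (b *+ 4)%R = b * 4 %[mod 2 ^ k./2.+1].
    by rewrite Zp_mulrn /= hm modn_dvdm // dvdn_exp2l.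
  move=> aa'; rewrite !four; have := congr1 (muln^~ 4) aa'.
  rewrite !muln_modl // => E; have dv : 2 ^ k./2.+1 %| 2 ^ k./2 * 4.
    by rewrite expnSr dvdn_mul.
  by rewrite -(modn_dvdm _ dv) E modn_dvdm.
rewrite /wbit /sigma /affine_gen; case: j => [[] []] /=; case: (odd k) => /=;
  rewrite ?addbb // ?hm ?bit_modn //; apply: bit_add_carry => //;
  by move: (e4 _ _ h1) (e4 _ _ h2); rewrite /= !hm.
Qed.

(* At a good point no digit wraps around, except for the overflow handled by
   [carry_map]. *)
Definition good (x : X) : bool :=
  [forall k : 'I_n.*2, (i0.*2 <= k) ==> (dgt x.2 k + 2 ^ k./2 <= 2 ^ exi k)].

Definition overflow p (x : X) k : bool := 2 ^ exi k <= dgt x.2 k + dgt (high_shift i0 p x.1) k.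

Definition base (x : X) : nat := rank x i0.*2.

(** A piece freezes the bits below [i0.*2], which have no companion digit to prevent wrap-around,
    and the overflow of the digit [i0.*2] for [p = false], which is not passed on. *)
Definition piece (c : nat * bool) : pred X :=
  fun x => [&& good x, base x == c.1 & overflow false x i0.*2 == c.2].

Lemma piece_good c x k : piece c x -> i0.*2 <= k < n.*2 -> dgt x.2 k + 2 ^ k./2 <= 2 ^ exi k.
Proof.
case/and3P => /forallP h _ _ /andP[ik kn].
by have := h (Ordinal kn); rewrite /= ik.
Qed.

Lemma piece_base c x x' k : piece c x -> piece c x' -> k < i0.*2 -> digit x k = digit x' k.
Proof.
case/and3P => _ /eqP b1 _ /and3P[_ /eqP b2 _] ki.
by apply: (rank_digit (m := i0.*2)) => //; rewrite -/(base x) b1.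
Qed.

Lemma digit_nat_base u k : k < i0.*2 -> dgt u k = 0.
Proof. by move=> ki; have := digit_nat_lt u k; rewrite /digit_exp ki expn0; case: (dgt u k). Qed.

Lemma digit_expE k : i0.*2 <= k -> 2 ^ exi k = 2 ^ (k./2.-1) * 2 ^ (k./2.-1).
Proof. by move=> ki; rewrite /digit_exp ltnNge ki -expnD addnn. Qed.

Lemma two_lt_half k : i0.*2 <= k -> 2 <= 2 ^ k./2.
Proof. by move=> ki; rewrite -{1}[2]expn1 leq_exp2l //; lia. Qed.

Lemma rank_mono_base c (M : X -> X) :
  (forall x x' k, piece c x -> piece c x' -> k < i0.*2 ->
     (forall j, j < i0.*2 -> wbit x.1 j = wbit x'.1 j) -> wbit (M x).1 k = wbit (M x').1 k) ->
  rank_mono (piece c) M (rank^~ i0.*2).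
Proof.
move=> h x x' px px'; have eq_base := piece_base px px'.
have E := eq_rank eq_base.
have E' : rank (M x) i0.*2 = rank (M x') i0.*2.
  apply: eq_rank => k ki; rewrite /digit !digit_nat_base //; congr (_ + nat_of_bool _).
  apply: h => // j ji; apply: digit_wbit; exact: eq_base.
by rewrite E E' ltnn; split=> //; rewrite ltnn.
Qed.

Lemma rank_mono_digits c (M : X -> X) (a : X -> nat -> nat) m :
  rank_mono (piece c) M (rank^~ i0.*2) -> i0.*2 <= m ->
  (forall x k, piece c x -> i0.*2 <= k < m -> digit (M x) k = digit x k + a x k) ->
  (forall x x' k, piece c x -> piece c x' -> i0.*2 <= k < m ->
     (forall j, j < k -> digit x j = digit x' j) -> a x k = a x' k) ->
  rank_mono (piece c) M (rank^~ m).
Proof.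
move=> hb; elim: m => [|m IH] im hd ha; first by rewrite leqn0 in im; rewrite -(eqP im).
have [E|lt_im] := eqVneq i0.*2 m.+1; first by rewrite -E.
have {}im : i0.*2 <= m by lia.
apply: (@rank_mono_step _ _ _ _ (fun x => digit x m) (fun x => a x m) (fun=> 0)).
- apply: IH => // [x k px km|x x' k px px' km hj]; first by apply: hd => //; lia.
  by apply: ha => //; lia.
- by move=> x; apply: digit_lt.
- by move=> x px; rewrite addn0; apply: hd => //; lia.
- move=> x x' px px' /rank_digit hr; split=> //; apply: ha => //; lia.
Qed.

Lemma sigma_rank_mono c j : rank_mono (piece c) (tower_map (inl j)) (rank^~ n.*2).
Proof.
apply: (rank_mono_digits (a := fun x k => wbit x.1 k (+) wbit (sigma j x.1) k)).
- apply: rank_mono_base => x x' k px px' ki hw /=.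
  have := @sigma_triangular j x.1 x'.1 k; rewrite (hw k ki) => /(_ _ _)/addIb; apply; first by lia.
  by move=> i ik; apply: hw; apply: ltn_trans ki.
- by rewrite leq_double ltnW.
- move=> x k px km; have gk := piece_good px km.
  have /andP[ik kn] := km; rewrite /digit /= digit_nat_add //.
  rewrite (digit_nat_ffun (fun k => wbit x.1 k && ~~ wbit (sigma j x.1) k)) //.
  have := two_lt_half ik; set w := wbit x.1 k; set w' := wbit _ k => h2.
  rewrite [(w && ~~ w') %% _]modn_small; last by case: (_ && _); lia.
  rewrite modn_small; last by case: (_ && _); lia.
  by case: (w); case: (w') => /=; lia.
- move=> x x' k px px' /andP[_ kn] hj; congr nat_of_bool.
  rewrite [LHS]addbC [RHS]addbC; apply: sigma_triangular => // i ik.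
  by apply: digit_wbit; apply: hj.
Qed.

Lemma wbits_modn x x' k (i : nat) : i.*2 <= k.+1 ->
  (forall j, j < k -> digit x j = digit x' j) -> x.1.1 = x'.1.1 %[mod 2 ^ i].
Proof.
move=> ik hj; apply: eq_modn_bits => t ti.
have := @digit_wbit x x' t.*2; rewrite /wbit odd_double doubleK; apply.
by apply: hj; lia.
Qed.

Lemma digit_nat_shift sw cc p (z : Z) k : k < n.*2 ->
  dgt (shift_digits i0 (n := n) sw cc p z) k =
    ((odd k == p) * wbit z (sw k) * cc k z.1) %% 2 ^ exi k.
Proof.
by move=> kn; rewrite (digit_nat_ffun (fun k => (odd k == p) * wbit z (sw k) * cc k z.1)).
Qed.

Lemma digit_nat_low_shift p (z : Z) k : i0.*2 <= k < n.*2 ->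
  dgt (low_shift i0 p z) k = (odd k == p) * wbit z (k./2.*2.-1) * (z.1 %% 2 ^ k./2).
Proof.
move=> /andP[ki kn]; rewrite digit_nat_shift // modn_small // digit_expE //.
apply: leq_ltn_trans (_ : z.1 %% 2 ^ k./2 < _).
  by case: (_ == _); case: (wbit _ _); rewrite ?mul0n ?mul1n.
apply: leq_trans (_ : 2 ^ k./2 <= _); first by rewrite ltn_pmod ?expn_gt0.
by rewrite -expnD leq_exp2l //; lia.
Qed.

Lemma low_shift_rank_mono c p : rank_mono (piece c) (tower_map (inr (inl p))) (rank^~ n.*2).
Proof.
apply: (rank_mono_digits (a := fun x k => 2 * dgt (low_shift i0 p x.1) k)).
- by apply: rank_mono_base => x x' k px px' ki hw /=; apply: hw.
- by rewrite leq_double ltnW.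
- move=> x k px km; have gk := piece_good px km; have /andP[ik kn] := km.
  rewrite /digit /= digit_nat_add // modn_small; first by lia.
  apply: leq_trans gk; rewrite ltn_add2l digit_nat_low_shift //.
  apply: leq_ltn_trans (_ : x.1.1 %% 2 ^ k./2 < _); last by rewrite ltn_pmod ?expn_gt0.
  by case: (_ == _); case: (wbit _ _); rewrite ?mul0n ?mul1n.
- move=> x x' k px px' km hj; rewrite !digit_nat_low_shift //.
  rewrite (wbits_modn (k := k) _ hj); last by lia.
  rewrite (digit_wbit (hj _ _)) //; lia.
Qed.

Lemma digit_carry_map_shift c p x k : piece c x -> i0.*2 <= k < n.*2 -> odd k = p ->
  digit (carry_map p x) k + radix k * overflow p x k = digit x k + 2 * dgt (high_shift i0 p x.1) k.
Proof.
move=> px /andP[ik kn] ok; rewrite /digit /radix /carry_map /= wbit_of_wbits //.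
have -> : carry p x.1 x.2 k = false by rewrite /carry ok eqxx andbF.
have -> : dgt (x.2 + high_shift i0 p x.1 + carry_vec p x.1 x.2)%R k =
    (dgt x.2 k + dgt (high_shift i0 p x.1) k) %% 2 ^ exi k.
  rewrite -[k]/(val (Ordinal kn)) !digit_natE !digit_addE carry_vec_par // addr0 /=.
  by congr (_ %% _); rewrite max_digitS.
rewrite addbF /overflow; have := digit_nat_lt x.2 k; have := digit_nat_lt (high_shift i0 p x.1) k.
move: (dgt (high_shift i0 p x.1) k) (dgt x.2 k) (2 ^ _) (nat_of_bool (wbit _ _)) => h u Q w hQ uQ.
case: (leqP Q (u + h)) => huQ; last by rewrite modn_small //; lia.
by rewrite -[u + h](subnK huQ) modnDr modn_small; lia.
Qed.

(** Flipping the bit and carrying into [u_k] when it was set adds exactly 1 to [2 u_k + w_k]; at a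
    good point [u_k] has room for it. *)
Lemma digit_carry_map_carry c p x k : piece c x -> i0.*2 <= k < n.*2 -> odd k != p ->
  digit (carry_map p x) k = digit x k + ((k.+1 < n.*2) && overflow p x k.+1).
Proof.
move=> px km ok; have gk := piece_good px km; have /andP[ik kn] := km.
rewrite /digit /carry_map /= wbit_of_wbits //; have h2 := two_lt_half ik.
have cE : carry p x.1 x.2 k = (k.+1 < n.*2) && overflow p x k.+1 by rewrite /carry ik ok.
have -> : dgt (x.2 + high_shift i0 p x.1 + carry_vec p x.1 x.2)%R k =
    dgt x.2 k + (carry p x.1 x.2 k && wbit x.1 k).
  rewrite digit_nat_add // digit_nat_add // /high_shift digit_nat_shift // (negPf ok) !mul0n mod0n addn0.
  rewrite [dgt x.2 k %% _]modn_small ?digit_nat_lt //.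
  rewrite (digit_nat_ffun (fun k => carry p x.1 x.2 k && wbit x.1 k)) //.
  rewrite [(_ && _) %% _]modn_small ?modn_small //; case: (_ && _); lia.
rewrite cE; move: (dgt _ _) ((k.+1 < n.*2) && _) => u b.
by case: (wbit x.1 k); case: b => /=; lia.
Qed.

Lemma eq_digit_nat_high_shift p x x' k : i0.*2 <= k < n.*2 ->
  (forall j, j < k.-1 -> digit x j = digit x' j) -> dgt (high_shift i0 p x.1) k = dgt (high_shift i0 p x'.1) k.
Proof.
move=> /andP[ik kn] h; rewrite -[k]/(val (Ordinal kn)) !digit_natE; congr nat_of_ord.
by apply: eq_high_shift => // j jk; apply: digit_wbit; apply: h.
Qed.

Lemma rank_mono_ext (S : pred X) M r r' : r =1 r' -> rank_mono S M r -> rank_mono S M r'.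
Proof. by move=> e h x x' Sx Sx'; rewrite -!e; apply: h. Qed.

(** The digits [k.-1] and [k] are read as one two-place number; passing on the overflow turns the
    cyclic shift of the digit [k] into an ordinary addition to this number. *)
Lemma carry_map_mono_pair c p k : odd k = p -> 0 < k -> i0.*2 <= k.-1 -> k < n.*2 ->
  rank_mono (piece c) (carry_map p) (rank^~ k.-1) -> rank_mono (piece c) (carry_map p) (rank^~ k.+1).
Proof.
move=> ok k0 ik kn hm; have k1 : k.-1.+1 = k by rewrite prednK.
have ik' : i0.*2 <= k by lia.
apply: (@rank_mono_ext _ _ (fun x => rank x k.-1 * (radix k.-1 * radix k) +
    (digit x k.-1 * radix k + digit x k))) => [x|].
  have rk : rank x k = rank x k.-1 * radix k.-1 + digit x k.-1 by rewrite -{1}k1.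
  by rewrite /= rk mulnDl mulnA addnA.
apply: (@rank_mono_step _ _ _ _ (fun x => digit x k.-1 * radix k + digit x k)
   (fun x => 2 * dgt (high_shift i0 p x.1) k) (fun=> 0)) => //.
- move=> x; have := digit_lt x k; have := digit_lt x k.-1; nia.
- move=> x px; have ok' : odd k.-1 != p by rewrite -ok -{2}k1 /=; case: (odd _).
  have := digit_carry_map_shift px _ ok; rewrite ik' kn => /(_ isT).
  have := digit_carry_map_carry px _ ok'; rewrite ik (leq_ltn_trans (leq_pred k) kn) => /(_ isT).
  rewrite k1 kn andTb => -> E; rewrite addn0 mulnDl.
  move: E; move: (digit (carry_map p x) k) (digit x k.-1) (digit x k) (radix k) (nat_of_bool _) (dgt _ _).
  by move=> y1 y2 y3 r o h; nia.
- move=> x x' px px' /rank_digit h; split=> //; congr (2 * _).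
  by apply: eq_digit_nat_high_shift => //; rewrite ik' kn.
Qed.

Lemma carry_map_mono_base c p : rank_mono (piece c) (carry_map p) (rank^~ i0.*2).
Proof.
apply: rank_mono_base => x x' k px px' ki hw; rewrite /carry_map /= !wbit_of_wbits; try lia.
by rewrite /carry !(leqNgt i0.*2) ki /= !addbF; apply: hw.
Qed.

Lemma carry_map_rank_mono c p : rank_mono (piece c) (tower_map (inr (inr p))) (rank^~ n.*2).
Proof.
case: p.
  (* For [p = true] the pairs of digits are [2 j] and [2 j + 1]. *)
  suff H t : i0 + t <= n -> rank_mono (piece c) (carry_map true) (rank^~ (i0 + t).*2).
    by have := H (n - i0); rewrite subnKC ?(ltnW i0_lt) //; apply.
  elim: t => [|t IH] ht; first by rewrite addn0; apply: carry_map_mono_base.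
  rewrite addnS doubleS; apply: (@carry_map_mono_pair _ _ (i0 + t).*2.+1); try lia.
  by apply: IH; lia.
(* For [p = false] the pairs are [2 j - 1] and [2 j]. The last digit stays single, and so does the
   digit [i0.*2], whose wrap-around is constant on the piece. *)
suff H t : i0 + t < n -> rank_mono (piece c) (carry_map false) (rank^~ (i0 + t).*2.+1).
  have hn : n.*2 = n.-1.*2.+2 by lia.
  have := H (n.-1 - i0); rewrite subnKC; last by lia.
  move=> /(_ ltac:(lia)) hm.
  apply: (@rank_mono_ext _ _ (rank^~ n.-1.*2.+2)) => [x|]; first by congr (rank x _); lia.
  have km : i0.*2 <= n.-1.*2.+1 < n.*2 by lia.
  apply: (@rank_mono_step _ _ _ _ (fun x => digit x n.-1.*2.+1) (fun=> 0) (fun=> 0)) => //.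
  - by move=> x; apply: digit_lt.
  - move=> x px; have := digit_carry_map_carry px km (p := false); rewrite /= odd_double => /(_ isT)->.
    by rewrite -hn ltnn /= !addn0.
elim: t => [|t IH] ht.
  rewrite addn0; have km : i0.*2 <= i0.*2 < n.*2 by lia.
  apply: (@rank_mono_step _ _ _ _ (fun x => digit x i0.*2)
     (fun x => 2 * dgt (high_shift i0 false x.1) i0.*2) (fun x => radix i0.*2 * overflow false x i0.*2)).
  - exact: carry_map_mono_base.
  - by move=> x; apply: digit_lt.
  - by move=> x px; apply: digit_carry_map_shift px _ _ => //; rewrite odd_double.
  - move=> x x' px px' /rank_digit h; split.
      congr (2 * _); apply: eq_digit_nat_high_shift => // j jk; apply: h.
      exact: leq_trans jk (leq_pred _).
    by case/and3P: px => _ _ /eqP->; case/and3P: px' => _ _ /eqP->.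
rewrite addnS doubleS; apply: (@carry_map_mono_pair _ _ (i0 + t).*2.+2); try lia.
by apply: IH; lia.
Qed.

Lemma tower_rank_mono c m : rank_mono (piece c) (tower_map m) (rank^~ n.*2).
Proof.
by case: m => [j|[p|p]]; [apply: sigma_rank_mono | apply: low_shift_rank_mono | apply: carry_map_rank_mono].
Qed.

End Rank.

(** * Density of the points where a digit may wrap around *)

Section BadSet.
Variables (R : rcfType) (i0 n : nat).
Hypotheses (i0_ge3 : 3 <= i0) (i0_lt : i0 < n).
Local Notation Z := (core n).
Local Notation U := (digits n.*2 (max_digit i0)).
Local Notation X := (Z * U)%type.

Lemma card_top_digits Q A : #|[set c : 'I_Q | Q < c + A]| <= A.
Proof.
case: A => [|A].
  rewrite leqn0 cards_eq0; apply/eqP/setP => c; rewrite !inE addn0.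
  by apply/negbTE; rewrite -leqNgt ltnW.
rewrite -[in leqRHS](card_ord A.+1).
rewrite -(card_in_imset (f := fun c : 'I_Q => inord (Q.-1 - c) : 'I_A.+1)); first exact: max_card.
move=> c d; rewrite !inE => hc hd /(congr1 val); rewrite /= !inordK; try lia.
by have := ltn_ord c; have := ltn_ord d => ? ? ?; apply: val_inj => /=; lia.
Qed.

(** The digit [k] is uniformly distributed: pairs of a point and a translation of this digit are
    counted in two ways. *)
Lemma card_digit_in (k : 'I_n.*2) (P : pred 'I_(max_digit i0 k).+1) :
  (max_digit i0 k).+1 * #|[set u : U | P (u k)]| = #|[set c | P c]| * #|{: U}|.
Proof.
pose S := \sum_(u : U) \sum_(c : 'I_(max_digit i0 k).+1) (P (u k + c)%R : nat).
transitivity S.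
  rewrite /S exchange_big -{1}(card_ord (max_digit i0 k).+1) -sum_nat_const /=.
  apply: eq_bigr => c _.
  rewrite -sum1_card [LHS]big_mkcond [LHS](reindex_inj (addIr (unit_digit (max_digit i0) k *+ c)%R)) /=.
  apply: eq_bigr => u _; rewrite inE digit_addE digit_muln ffunE eqxx Zp_muln1 valZpK.
  by case: (P _).
rewrite /S [RHS]mulnC -sum_nat_const; apply: eq_bigr => u _.
rewrite -sum1_card [RHS]big_mkcond [RHS](reindex_inj (addrI (u k))) /=.
by apply: eq_bigr => c _; rewrite inE; case: (P _).
Qed.

Lemma card_bad_digit (k : 'I_n.*2) : i0.*2 <= k ->
  half_scale k * #|[set x : X | 2 ^ digit_exp i0 k < digit_nat x.2 k + 2 ^ k./2]| <= 2 * #|{: X}|.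
Proof.
move=> ik; pose P (c : 'I_(max_digit i0 k).+1) := 2 ^ digit_exp i0 k < c + 2 ^ k./2.
have -> : #|[set x : X | 2 ^ digit_exp i0 k < digit_nat x.2 k + 2 ^ k./2]| =
    #|{: Z}| * #|[set u : U | P (u k)]|.
  rewrite -cardsT -cardsX; apply: eq_card => -[z u].
  by rewrite !inE /= digit_natE /P.
have := card_digit_in P; have : #|[set c | P c]| <= 2 ^ k./2.
  apply: leq_trans (card_top_digits (max_digit i0 k).+1 (2 ^ k./2)).
  by apply: subset_leq_card; apply/subsetP => c; rewrite !inE /P -max_digitS.
move: #|[set c | P c]| #|[set u : U | P (u k)]| => C Uc.
rewrite max_digitS digit_expE // -/(half_scale k) (card_prod Z U).
have -> : 2 ^ k./2 = 2 * half_scale k by rewrite /half_scale -expnS; congr (_ ^ _); lia.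
have m0 : 0 < half_scale k by rewrite expn_gt0.
move: #|{: Z}| #|{: U}| => N D h1 h2.
have : half_scale k * (half_scale k * Uc) <= half_scale k * (2 * D).
  by rewrite [leqLHS]mulnA h2 [leqRHS]mulnCA mulnA leq_mul2r h1 orbT.
by rewrite leq_pmul2l // => h; rewrite mulnCA [leqRHS]mulnCA leq_mul2l h orbT.
Qed.

(** A union bound over the digits; the proportions [2 / half_scale k] add up to [rho]. *)
Lemma card_bad : 2 ^ i0 * #|[set x : X | ~~ good x]| <= 16 * #|{: X}|.
Proof.
pose bad (k : 'I_n.*2) := [set x : X | 2 ^ digit_exp i0 k < digit_nat x.2 k + 2 ^ k./2].
have le_sum : #|[set x : X | ~~ good x]| <= \sum_(k : 'I_n.*2 | i0.*2 <= k) #|bad k|.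
  under [leqRHS]eq_bigr do rewrite -sum1_card big_mkcond.
  rewrite -sum1_card exchange_big [leqLHS]big_mkcond; apply: leq_sum => x _.
  rewrite inE; case: ifP => // /forallPn[k]; rewrite negb_imply -ltnNge => /andP[ik bk].
  by rewrite (bigD1 k) //= inE bk.
have sum_le : ((\sum_(k : 'I_n.*2 | (i0.*2 <= k)%N) #|bad k|)%:R <= rho R i0 n * #|{: X}|%:R :> R)%R.
  rewrite natr_sum /rho mulr_suml; apply: ler_sum => k ik.
  rewrite mulrAC ler_pdivlMr ?half_scale_gt0 // -!natrM ler_nat mulnC.
  exact: card_bad_digit.
have p0 : (0 < (2 ^ i0)%:R :> R)%R by rewrite ltr0n expn_gt0.
have h := rho_le R i0_ge3 i0_lt; rewrite ler_pdivlMr // in h.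
rewrite -(ler_nat R) !natrM; move: le_sum; rewrite -(ler_nat R) => le_sum.
have := le_trans le_sum sum_le; rewrite -(ler_pM2l p0) => /le_trans; apply.
by rewrite mulrA ler_wpM2r // mulrC.
Qed.

End BadSet.

(** * From monotone maps to graphs *)

Section Prune.
Variables (X : finType) (J : finType) (D : J -> pred X) (M : J -> X -> X) (K : nat).

Definition exits (V T : {set X}) :=
  \sum_j #|[set x in T | D j x && (M j x \in V :\: T)]|.

Hypothesis expand : forall T : {set X},
  #|X| <= 4 * #|T| -> 4 * #|T| <= 3 * #|X| -> #|X| <= K * exits setT T.

(* [V] is the complement of a largest set among those of density at most 1/4
   with at most [1/K] exits per element. *)
Lemma prune : exists V : {set X}, 3 * #|X| <= 4 * #|V| /\
  forall T : {set X}, T \subset V -> 3 * #|T| <= 2 * #|V| -> #|T| <= K * exits V T.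
Proof.
pose small (R : {set X}) := (4 * #|R| <= #|X|) && (K * exits setT R <= #|R|).
have s0 : small set0.
  rewrite /small cards0 /exits big1 ?muln0 // => j _; apply/eqP.
  by rewrite cards_eq0; apply/eqP/setP => x; rewrite !inE.
case: (arg_maxnP (fun R : {set X} => #|R|) s0) => R /andP[R4 eR] maxR.
exists (~: R); have cR := cardsC R; split; first by lia.
move=> T TV T23; rewrite leqNgt; apply/negP => eT.
have dTR : [disjoint R & T] by rewrite disjoint_sym disjoints_subset.
have cRT : #|R :|: T| = #|R| + #|T| by rewrite cardsU disjoint_setI0 // cards0 subn0.
have eRT : exits setT (R :|: T) <= exits setT R + exits (~: R) T.
  rewrite /exits -big_split; apply: leq_sum => j _ /=.
  apply: leq_trans (leq_card_setU _ _); apply: subset_leq_card; apply/subsetP => x.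
  rewrite !inE ?andbT; case: (x \in R); case: (x \in T); case: (D j x); case: (M j x \in R); by case: (M j x \in T).
have eRT' : K * exits setT (R :|: T) < #|R :|: T|.
  rewrite cRT; apply: leq_ltn_trans (_ : K * exits setT R + K * exits (~: R) T < _).
    by rewrite -mulnDr leq_mul2l eRT orbT.
  by rewrite -addnS leq_add.
(* Either the union is still small, against the maximality of [R], or its density is at least
   [1 / 4] and at most [1 / 4 + 2 / 3 * 3 / 4 = 3 / 4], against [expand]. *)
have [lt|ge] := leqP (4 * #|R :|: T|) #|X|.
  have := maxR (R :|: T); rewrite /small lt (ltnW eRT') => /(_ isT); lia.
have := expand (ltnW ge); have := max_card (mem (R :|: T)) => h1 /(_ ltac:(lia)); lia.
Qed.

End Prune.

(** * The layered cyclic graph and its queue layout *)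

Section CyclicGraph.
Variables (Y : finType) (m' : nat).
Local Notation m := m'.+1.
Variables (E : 'I_m -> rel Y) (r : Y -> nat) (B : nat).
Hypothesis r_inj : injective r.
Hypothesis r_lt : forall x, r x < B.
(** Keeps the matchings away from both folds: the layers [2 i] and [2 i + 1] are columns other than
    the first and the last. *)
Hypothesis E_range : forall i x y, E i x y -> 0 < i /\ i.*2.+2 < m.
Hypothesis E_fun : forall i x y y', E i x y -> E i x y' -> y = y'.
Hypothesis E_mono : forall i x y x' y', E i x y -> E i x' y' -> r x < r x' -> r y < r y'.

Lemma E_inj i x x' y : E i x y -> E i x' y -> x = x'.
Proof.
move=> h h'; apply: r_inj; case: (ltngtP (r x) (r x')) => // lt.
  by have := E_mono h h' lt; rewrite ltnn.
by have := E_mono h' h lt; rewrite ltnn.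
Qed.

(** [v] stands for a vertex of the layer [2 v.1] and [w] for one of the layer [2 w.1 + 1].
    Cyclically consecutive layers are joined by the identity, and the layers [2 i] and [2 i + 1]
    also by [E i]. *)
Definition incident (v w : 'I_m * Y) : bool :=
  (v.2 == w.2) && ((w.1 == v.1) || (v.1 == ordS w.1)) || (v.1 == w.1) && E v.1 v.2 w.2.

Definition vertex := (bool * ('I_m * Y))%type.

Definition adj : rel vertex := fun v w =>
  (v.1 != w.1) && if v.1 then incident w.2 v.2 else incident v.2 w.2.

Definition side b : {set vertex} := [set v | v.1 == b].

Lemma adj_simple : simple_graph adj.
Proof.
split=> [[b v] [c w]|v]; last by rewrite /adj eqxx.
by rewrite /adj /= eq_sym; case: b; case: c.
Qed.

Lemma card_side b : #|side b| = m * #|Y|.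
Proof.
have -> : side b = (pair b) @: setT.
  apply/setP => -[c v]; rewrite inE /=; apply/eqP/imsetP => [->|[w _ [->]] //].
  by exists v.
by rewrite card_imset ?cardsT ?card_prod ?card_ord // => x y [].
Qed.

Lemma adj_bipartition : bipartition adj (side false) (side true).
Proof.
split; [|split].
- by rewrite -setI_eq0; apply/eqP/setP => -[[] v]; rewrite !inE.
- by apply/setP => -[[] v]; rewrite !inE.
- by move=> [[] v] [[] w]; rewrite /adj !inE.
Qed.

Lemma adj_degree v : #|nbhd adj v| <= 3.
Proof.
suff [a [b [c h]]] : exists a b c, forall w, adj v w -> w \in [set a; b; c].
  apply: leq_trans (_ : #|[set a; b; c]| <= 3).
    by apply: subset_leq_card; apply/subsetP => w; rewrite inE; apply: h.
  by rewrite setUC cardsU1 cards2; case: (_ \notin _); case: (_ != _).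
case: v => -[] [i x].
  exists (false, (i, x)), (false, (ordS i, x)).
  have [/existsP[y Ey]|/existsPn no] := boolP [exists y, E i y x].
    exists (false, (i, y)) => -[[] [k z]]; rewrite /adj /incident //= !inE.
    case/orP=> [/andP[/eqP-> /orP[]/eqP->]|/andP[/eqP-> Ez]]; rewrite ?eqxx ?orbT //.
    by rewrite (E_inj Ez Ey) eqxx orbT.
  exists (false, (i, x)) => -[[] [k z]]; rewrite /adj /incident //= !inE.
  case/orP=> [/andP[/eqP-> /orP[]/eqP->]|/andP[/eqP-> Ez]]; rewrite ?eqxx ?orbT //.
  by have := no z; rewrite Ez.
exists (true, (i, x)), (true, (ord_pred i, x)).
have [/existsP[y Ey]|/existsPn no] := boolP [exists y, E i x y].
  exists (true, (i, y)) => -[[] [k z]]; rewrite /adj /incident //= !inE.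
  case/orP=> [/andP[/eqP-> /orP[]/eqP->]|/andP[/eqP<- Ez]]; rewrite ?ordSK ?eqxx ?orbT //.
  by rewrite (E_fun Ez Ey) eqxx orbT.
exists (true, (i, x)) => -[[] [k z]]; rewrite /adj /incident //= !inE.
case/orP=> [/andP[/eqP-> /orP[]/eqP->]|/andP[/eqP<- Ez]]; rewrite ?ordSK ?eqxx ?orbT //.
by have := no z; rewrite Ez.
Qed.

Lemma adj_max_degree i x y : E i x y -> x != y -> max_degree adj 3.
Proof.
move=> Exy xy; split=> [v|]; first exact: adj_degree.
exists (false, (i, x)); apply/eqP; rewrite eqn_leq adj_degree /=.
have [i0 im] := E_range Exy.
have pi : ord_pred i != i.
  have Ei : (i + m).-1 = i.-1 + m by lia.
  apply/negP => /eqP/(congr1 val); rewrite /= Ei modnDr modn_small; have := ltn_ord i; lia.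
pose s : seq vertex := [:: (true, (i, x)); (true, (ord_pred i, x)); (true, (i, y))].
have us : uniq s by rewrite /= !inE !xpair_eqE /= !eqxx /= (negPf xy) andbF orbF andbT eq_sym pi.
rewrite -[3]/(size s) -(card_uniqP us); apply: subset_leq_card; apply/subsetP => w; rewrite !inE.
by case/or3P => /eqP->; rewrite /adj /incident /= ?ord_predK ?eqxx ?Exy ?orbT.
Qed.

(* The cycle of [2 m] layers is folded at the layers [m]: layers [l] and
   [2 m - 1 - l] share the column [l < m]. *)
Definition layer (v : vertex) : nat := v.2.1.*2 + v.1.
Definition column v := if layer v < m then layer v else m.*2.-1 - layer v.
Definition pos v := column v * B.*2 + (r v.2.2).*2 + (m <= layer v).
(** On edges, class 0 consists of the identity edges between different columns. *)
Definition col (v w : vertex) : 'I_2 := inord ((v.2.2 != w.2.2) || (column v == column w)).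

Lemma layer_lt v : layer v < m.*2.
Proof. by rewrite /layer; have := ltn_ord v.2.1; case: v.1 => /=; lia. Qed.

Lemma pos_inj : injective pos.
Proof.
move=> v w; have lv := layer_lt v; have lw := layer_lt w.
have dl u : (r u.2.2).*2 + (m <= layer u) < B.*2.
  by have := r_lt u.2.2; case: (m <= _); lia.
rewrite /pos -!addnA => /(divmod_uniq (dl v) (dl w))[Ec Er].
have rE : r v.2.2 = r w.2.2 by move: Er; case: (m <= layer v); case: (m <= layer w); lia.
have lE : layer v = layer w.
  move: Ec Er; rewrite rE /column.
  by case: (ltnP (layer v)); case: (ltnP (layer w)); lia.
case: v w rE lE {lv lw Ec Er} => [b [i x]] [c [k y]] /= /r_inj-> lE.
have [-> ik] : b = c /\ i = k :> nat by move: lE; rewrite /layer /=; case: b; case: c => /=; lia.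
by rewrite (val_inj ik).
Qed.

Definition span v w p q := pos v = p /\ pos w = q \/ pos v = q /\ pos w = p.

Inductive edge_kind v w : Prop :=
| Across p of span v w p (p + B.*2) & col v w = 0 :> nat
| Fold c x of c = 0 \/ c = m' & span v w (c * B.*2 + (r x).*2) (c * B.*2 + (r x).*2).+1
    & col v w = 1 :> nat
| Matching i x y of E i x y
    & span v w (i.*2 * B.*2 + (r x).*2) (i.*2.+1 * B.*2 + (r y).*2) & col v w = 1 :> nat.

Lemma col_sym v w : col v w = col w v.
Proof. by rewrite /col eq_sym (eq_sym (column v)). Qed.

Lemma colE v w : col v w = ((v.2.2 != w.2.2) || (column v == column w)) :> nat.
Proof. by rewrite inordK //; case: (_ || _). Qed.

Lemma edge_kind_sym v w : edge_kind v w -> edge_kind w v.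
Proof.
have ss p q : span v w p q -> span w v p q by case=> -[]; [right | left].
case=> [p /ss s c|c x hc /ss s h|i x y e /ss s h]; rewrite col_sym in c || rewrite col_sym in h.
- exact: Across s c.
- exact: Fold hc s h.
- exact: Matching e s h.
Qed.

Lemma adj_kind v w : adj v w -> edge_kind v w.
Proof.
wlog vf : v w / v.1 = false => [H vw|].
  case Ev : v.1; last exact: H.
  apply: edge_kind_sym; apply: H; last by rewrite adj_simple.1.
  by move: vw; rewrite /adj Ev; case: w.1.
case: v w vf => [_ [i x]] [b [k y]] /= ->; case: b; rewrite /adj // /incident /=.
have iM := ltn_ord i; have kM := ltn_ord k.
case/orP=> [/andP[/eqP<-{y} h]|/andP[/eqP E1 e]]; last first.
  subst k; have [i0 im] := E_range e.
  have c1 : column (false, (i, x)) = i.*2 by rewrite /column /layer /= addn0 ifT //; lia.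
  have c2 : column (true, (i, y)) = i.*2.+1 by rewrite /column /layer /= addn1 ifT //; lia.
  have p1 : pos (false, (i, x)) = i.*2 * B.*2 + (r x).*2.
    by rewrite /pos c1 /layer /= addn0 leqNgt (_ : i.*2 < m) ?addn0 //; lia.
  have p2 : pos (true, (i, y)) = i.*2.+1 * B.*2 + (r y).*2.
    by rewrite /pos c2 /layer /= addn1 leqNgt (_ : i.*2.+1 < m) ?addn0 //; lia.
  (* A matching edge with [x = y] coincides with an identity edge and gets its class. *)
  have [exy|xy] := eqVneq x y; last by apply: (Matching e); [left | rewrite colE /= xy].
  apply: (@Across _ _ (i.*2 * B.*2 + (r x).*2)); last first.
    by rewrite colE c1 c2 /= exy eqxx (ltn_eqF (ltnSn _)).
  by left; rewrite p1 p2 exy mulSn; split; lia.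
pose v : vertex := (false, (i, x)); pose w : vertex := (true, (k, x)).
have : [\/ layer w = (layer v).+1, layer v = (layer w).+1 | layer v = 0 /\ layer w = m.*2.-1].
  rewrite /layer /= addn0 addn1; case/orP: h => /eqP/(congr1 val) /=.
    by move=> ->; constructor 1.
  move=> E1; have [lt|ge] := ltnP k.+1 m.
    by constructor 2; move: E1; rewrite modn_small //; lia.
  constructor 3; move: E1; have -> : k.+1 = m by lia.
  by rewrite modnn; lia.
have [xv xw] : v.2.2 = x /\ w.2.2 = x by [].
rewrite -/v -/w; move: v w xv xw => v w xv xw h3.
have lv := layer_lt v; have lw := layer_lt w.
have : (column v = column w /\ (column v = 0 \/ column v = m') /\
      (m <= layer v) + (m <= layer w) = 1) \/
    ((m <= layer v) = (m <= layer w) :> nat /\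
      (column w = (column v).+1 \/ column v = (column w).+1)).
  move: lv lw h3; rewrite /column; case: (ltnP (layer v) m); case: (ltnP (layer w) m);
  by move: (layer v) (layer w) => a b ? ? ? ? [] *; rewrite /=; lia.
have pv : pos v = column v * B.*2 + (r x).*2 + (m <= layer v) by rewrite /pos xv.
have pw : pos w = column w * B.*2 + (r x).*2 + (m <= layer w) by rewrite /pos xw.
case=> [[Ec [cc Es]]|[Es Ec]].
  apply: (@Fold _ _ (column v) x cc); last by rewrite colE -Ec !eqxx orbT.
  rewrite /span pv pw -Ec; move: Es; case: (m <= layer v); case: (m <= layer w); lia.
have h0 : (column v == column w) = false by apply/negbTE/eqP; lia.
case: Ec => Ec.
  apply: (@Across _ _ (pos v)); last by rewrite colE h0 xv xw eqxx.
  by left; rewrite pv pw Ec Es mulSn; lia.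
apply: (@Across _ _ (pos w)); last by rewrite colE h0 xv xw eqxx.
by right; rewrite pv pw Ec Es mulSn; lia.
Qed.

(** Edges of class 0 have equal length. In class 1 nothing fits inside a [Fold] edge, [Fold] edges
    lie outside the columns of the matchings, and two [Matching] edges lie in disjoint pairs of
    columns or belong to one monotone matching. *)
Lemma adj_queue : queue_layout adj pos col.
Proof.
split; first exact: pos_inj.
split=> [v w _|a b c d]; first exact: col_sym.
have span_lt u v p q : span u v p q -> pos u < pos v -> p < q -> pos u = p /\ pos v = q.
  by case=> -[-> ->] //; lia.
move=> /adj_kind k1 /adj_kind k2 /(congr1 val) /= Ecol [ac cd db].
have ab : pos a < pos b by lia.
have B0 : 0 < B by apply: leq_ltn_trans (r_lt a.2.2).
case: k1 => [p s1 c1|p x hp s1 c1|i x y e s1 c1];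
case: k2 => [p' s2 c2|p' x' hp' s2 c2|i' x' y' e' s2 c2]; rewrite ?c1 ?c2 in Ecol => //.
- by have := span_lt _ _ _ _ s1 ab; have := span_lt _ _ _ _ s2 cd; lia.
- by have := span_lt _ _ _ _ s1 ab; lia.
- by have := span_lt _ _ _ _ s1 ab; lia.
- have [i0 im] := E_range e; have hx := r_lt x; have hy := r_lt y.
  have := span_lt _ _ _ _ s2 cd (ltnSn _).
  have := span_lt _ _ _ _ s1 ab; rewrite mulSn => /(_ ltac:(lia)) [E1 E2] [E3 E4].
  case: hp' => hp'; rewrite hp' in E3 E4.
    have : B.*2 <= i.*2 * B.*2 by apply: leq_pmull; lia.
    by have := r_lt x'; lia.
  have : i.*2.+2 * B.*2 <= m' * B.*2 by rewrite leq_mul2r; lia.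
  by rewrite !mulSn; lia.
- have hx := r_lt x; have hy := r_lt y; have hx' := r_lt x'; have hy' := r_lt y'.
  have := span_lt _ _ _ _ s2 cd; have := span_lt _ _ _ _ s1 ab.
  rewrite !mulSn => /(_ ltac:(lia)) [E1 E2] /(_ ltac:(lia)) [E3 E4].
  have [lt|gt|/val_inj ii] := ltngtP i i'.
  + by have : i.*2.+2 * B.*2 <= i'.*2 * B.*2; [rewrite leq_mul2r; lia | rewrite !mulSn; lia].
  + by have : i'.*2.+2 * B.*2 <= i.*2 * B.*2; [rewrite leq_mul2r; lia | rewrite !mulSn; lia].
  + subst i'; have := E_mono e e'; lia.
Qed.
End CyclicGraph.

Lemma cyclic_bool m' (b : 'I_m'.+1 -> bool) i k :
  (forall l, b (ordS l) -> b l) -> b i -> b k.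
Proof.
move=> h bi; have down j : b (inZp (k + j)) -> b k.
  elim: j => [|j IH]; first by rewrite addn0 valZpK.
  have -> : inZp (k + j.+1) = ordS (inZp (k + j) : 'I_m'.+1).
    by apply/val_inj; rewrite /= -[((k + j) %% _).+1]addn1 modnDml addn1 addnS.
  by move/h.
apply: (down (i + m'.+1 - k)); rewrite subnKC.
  by rewrite (_ : inZp _ = i) //; apply/val_inj; rewrite /= modnDr modn_small.
by have := ltn_ord k; lia.
Qed.

Lemma card_image_le (T : finType) (A C : {set T}) (F : rel T) :
  (forall x, x \in A -> exists2 y, F x y & y \in C) ->
  (forall x x' y, F x y -> F x' y -> x = x') -> #|A| <= #|C|.
Proof.
move=> hA hF; pose f x := odflt x [pick y | F x y && (y \in C)].
have fP x : x \in A -> F x (f x) && (f x \in C).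
  by move=> /hA[y Fy Cy]; rewrite /f; case: pickP => //= /(_ y); rewrite Fy Cy.
rewrite -(card_in_imset (f := f)) => [|x x' /fP/andP[h _] /fP/andP[h' _] e]; last first.
  by rewrite e in h; apply: hF h h'.
by apply: subset_leq_card; apply/subsetP => y /imsetP[x /fP/andP[_ ?] ->].
Qed.

(** * Expansion of the layered cyclic graph *)

Section CyclicExpansion.
Variables (Y : finType) (m' K : nat).
Local Notation m := m'.+1.
Variables (E : 'I_m -> rel Y).
Hypothesis E_inj : forall i x x' y, E i x y -> E i x' y -> x = x'.
Hypothesis expand : forall T : {set Y}, 3 * #|T| <= 2 * #|Y| ->
  #|T| <= K * \sum_i #|[set x in T | [exists y, E i x y && (y \notin T)]]|.

(** The inverse of the expansion excess; it depends on the number of layers and on [K], not on the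
    size of [Y]. *)
Definition loss := m * (3 * m * K).+1.

(* [delta] bounds the difference of any two traces [T i], so the images of the
   smallest trace under [E i] are almost all new in [N i]. *)
Lemma cyclic_expansion (T N : 'I_m -> {set Y}) :
  (forall i, T i \subset N i) -> (forall i, T (ordS i) \subset N i) ->
  (forall i x y, E i x y -> x \in T i -> y \in N i) ->
  2 * \sum_i #|T i| <= m * #|Y| ->
  loss.+1 * \sum_i #|T i| <= loss * \sum_i #|N i|.
Proof.
move=> TN TSN EN hY.
have constE c : \sum_(i < m) c = m * c by rewrite sum_nat_const card_ord.
pose delta := \sum_i #|T (ordS i) :\: T i|.
pose mu i := #|N i :\: (T i :|: T (ordS i))|.
have hN : \sum_i #|N i| = \sum_i #|T i| + delta + \sum_i mu i.
  rewrite /delta -!big_split; apply: eq_bigr => i _ /=.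
  have -> : #|T i| + #|T (ordS i) :\: T i| = #|T i :|: T (ordS i)|.
    rewrite -(cardsID (T i) (T i :|: _)) setUK setDUl setDv set0U; congr (_ + _).
  rewrite -(cardsID (T i :|: T (ordS i)) (N i)); congr (_ + _).
  by rewrite (setIidPr _) // subUset TN TSN.
(* For a point of [T i] outside [T k] there is a place [l] on the cycle where it lies in
   [T (ordS l)] but not in [T l]; [delta] counts these. *)
have cmp i k : #|T i :\: T k| <= delta.
  rewrite /delta -[leqLHS]sum1_card big_mkcond.
  under [leqRHS]eq_bigr do rewrite -sum1_card big_mkcond.
  rewrite exchange_big; apply: leq_sum => x _; rewrite inE; case: ifP => // /andP[xk xi].
  have [l hl] : exists l, x \in T (ordS l) :\: T l.
    apply/existsP; apply: contraNT xk => /existsPn h.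
    apply: (@cyclic_bool _ (fun l => x \in T l) i) => // l xl.
    by have := h l; rewrite inE xl andbT negbK.
  by rewrite (bigD1 l) //= hl.
case: (arg_minnP (fun i => #|T i|) (isT : predT (ord0 : 'I_m))) => k _ kmin.
have mk : m * #|T k| <= \sum_i #|T i|.
  by rewrite -constE; apply: leq_sum => i _; apply: kmin.
(* The smallest trace is at most the average, which is at most [#|Y| / 2]. *)
have Tk : 3 * #|T k| <= 2 * #|Y|.
  have : m * (2 * #|T k|) <= m * #|Y| by rewrite mulnCA; lia.
  by rewrite leq_pmul2l //; lia.
(* One [delta] pays for the points of [T k] outside [T i], two for the images in [T i] or
   [T (ordS i)] outside [T k]. *)
have step i : #|[set x in T k | [exists y, E i x y && (y \notin T k)]]| <= 3 * delta + mu i.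
  set A := [set x in _ | _].
  have : #|A :&: T i| <= #|(N i :\: (T i :|: T (ordS i))) :|: (T i :\: T k) :|: (T (ordS i) :\: T k)|.
    apply: (card_image_le (F := E i)) => [x|]; last exact: E_inj.
    rewrite !inE => /andP[/andP[_ /existsP[y /andP[e yk]]] xi]; exists y => //.
    by rewrite !inE yk (EN _ _ _ e xi) /=; case: (y \in T i); case: (y \in T _).
  have := cardsID (T i) A; have : #|A :\: T i| <= #|T k :\: T i|.
    by apply: subset_leq_card; apply: setSD; apply/subsetP => x; rewrite inE => /andP[].
  have := (leq_card_setU ((N i :\: (T i :|: T (ordS i))) :|: (T i :\: T k)) (T (ordS i) :\: T k)).1.
  have := (leq_card_setU (N i :\: (T i :|: T (ordS i))) (T i :\: T k)).1.
  have := cmp i k; have := cmp (ordS i) k; have := cmp k i; rewrite /mu; lia.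
have Sk : \sum_i #|T i| <= m * (#|T k| + delta).
  rewrite -constE; apply: leq_sum => i _.
  have := cmp i k; have := cardsID (T k) (T i).
  have : #|T i :&: T k| <= #|T k| by apply: subset_leq_card; apply: subsetIr.
  lia.
have Ek : #|T k| <= K * (m * (3 * delta) + \sum_i mu i).
  apply: leq_trans (expand Tk) _; rewrite leq_mul2l; apply/orP; right.
  rewrite -constE -big_split.
  by apply: leq_sum => i _; apply: step.
rewrite hN mulSn -addnA mulnDr [leqRHS]addnC leq_add2r.
apply: leq_trans Sk _; rewrite /loss -mulnA leq_mul2l; apply/orP; right.
(* With [b = delta] and [a] the sum of the [mu i], [K * (3 * m * b + a) + b] is at most
   [(3 * m * K + 1) * (a + b)]. *)
move: Ek; clear; move: (\sum_i mu i) delta #|T k| => a b c; nia.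
Qed.

End CyclicExpansion.

Section AdjExpander.
Variables (R : realType) (Y : finType) (m' K : nat).
Local Notation m := m'.+1.
Variables (E : 'I_m -> rel Y).
Hypothesis E_inj : forall i x x' y, E i x y -> E i x' y -> x = x'.
Hypothesis expand : forall T : {set Y}, 3 * #|T| <= 2 * #|Y| ->
  #|T| <= K * \sum_i #|[set x in T | [exists y, E i x y && (y \notin T)]]|.

Lemma card_slices b (S : {set vertex Y m'}) :
  \sum_i #|[set x | (b, (i, x)) \in S]| = #|S :&: side Y m' b|.
Proof.
transitivity (\sum_(i : 'I_m) \sum_(x : Y | (b, (i, x)) \in S) 1).
  by apply: eq_bigr => i _; rewrite -sum1_card; apply: eq_bigl => x; rewrite inE.
rewrite pair_big_dep -sum1_card [RHS](reindex_onto (fun v => (b, v)) snd) /=.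
  by apply: eq_bigl => -[i x]; rewrite !inE !eqxx !andbT.
by move=> [c v]; rewrite !inE /= => /andP[_ /eqP->].
Qed.

Lemma adj_expander :
  bip_expander ((loss m' K)%:R^-1 : R) (adj E) (side Y m' false) (side Y m' true).
Proof.
split; first exact: adj_bipartition.
split; first by rewrite !card_side.
move=> S SA; rewrite card_side => hS; set NS := neighbourhood _ S.
pose T i := [set x | (false, (i, x)) \in S].
pose N i := [set x | (true, (i, x)) \in NS].
have TS : \sum_i #|T i| = #|S| by rewrite card_slices (setIidPl SA).
have NN : \sum_i #|N i| <= #|NS| by rewrite card_slices subset_leq_card ?subsetIl.
have NSI i x y k : (false, (i, x)) \in S -> incident E (i, x) (k, y) -> y \in N k.
  move=> xS inc; rewrite !inE; apply/existsP; exists (false, (i, x)).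
  by rewrite xS /adj.
have := @cyclic_expansion Y m' K E E_inj expand T N.
rewrite TS => /(_ _ _ _ hS) h.
have {}h : (loss m' K).+1 * #|S| <= loss m' K * #|NS|.
  apply: leq_trans (h _ _ _) _; last by rewrite leq_mul2l NN orbT.
  - by move=> i; apply/subsetP => x; rewrite inE => /NSI; apply; rewrite /incident /= !eqxx.
  - move=> i; apply/subsetP => x; rewrite inE => /NSI; apply.
    by rewrite /incident /= !eqxx orbT.
  - move=> i x y e; rewrite inE => /NSI; apply.
    by rewrite /incident /= eqxx e orbT.
have l0 : (0 < (loss m' K)%:R :> R)%R by rewrite ltr0n /loss muln_gt0.
rewrite -(ler_pM2l l0) mulrA mulrDr mulr1 divff ?gt_eqF //.
by rewrite natr1 -!natrM ler_nat.
Qed.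

End AdjExpander.

(** * Transport of the graph properties along a bijection *)

Section Transport.
Variables (R : realType) (T U : finType) (f : U -> T) (g : T -> U).
Hypotheses (fK : cancel f g) (gK : cancel g f).
Variable e : rel T.
Let e' : rel U := fun x y => e (f x) (f y).

Let f_bij : bijective f. Proof. by exists g. Qed.

Lemma card_preim_bij (A : {set T}) : #|f @^-1: A| = #|A|.
Proof. by rewrite on_card_preimset //; apply: onW_bij. Qed.

Lemma preim_neighbourhood (S : {set U}) : neighbourhood e' S = f @^-1: neighbourhood e (g @^-1: S).
Proof.
apply/setP => y; rewrite !inE; apply/existsP/existsP => -[x].
  by move=> /andP[xS exy]; exists (f x); rewrite inE fK xS.
by rewrite inE => /andP[xS exy]; exists (g x); rewrite xS /e' gK.
Qed.

Lemma card_preim_inv (A : {set U}) : #|g @^-1: A| = #|A|.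
Proof. by rewrite on_card_preimset //; apply: onW_bij; exists f. Qed.

Lemma bip_expander_preim eps A B : bip_expander (eps : R) e A B ->
  bip_expander eps e' (f @^-1: A) (f @^-1: B).
Proof.
move=> [[dAB [cAB eAB]] [cardAB h]]; split; first split; [|split|].
- rewrite -setI_eq0 -preimsetI.
  by move: dAB; rewrite -setI_eq0 => /eqP->; rewrite preimset0.
- by rewrite -preimsetU cAB; apply/setP => x; rewrite !inE.
- by move=> x y /eAB; rewrite !inE.
- split; first by rewrite !card_preim_bij.
  move=> S SA; rewrite card_preim_bij => cS.
  rewrite preim_neighbourhood card_preim_bij -(card_preim_inv S); apply: h.
    by apply/subsetP => x; rewrite inE => /(subsetP SA); rewrite inE gK.
  by rewrite card_preim_inv.
Qed.

Lemma simple_preim : simple_graph e -> simple_graph e'.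
Proof. by move=> [h1 h2]; split=> *; [apply: h1 | apply: h2]. Qed.

Lemma max_degree_preim d : max_degree e d -> max_degree e' d.
Proof.
have nE x : #|nbhd e' x| = #|nbhd e (f x)|.
  by rewrite -(card_preim_bij (nbhd e (f x))); apply: eq_card => y; rewrite !inE.
move=> [h1 [x hx]]; split=> [y|]; first by rewrite nE.
by exists (g x); rewrite nE gK.
Qed.

Lemma queue_preim k : has_queue_layout k e -> has_queue_layout k e'.
Proof.
move=> [pos [col [pi [cs h]]]]; exists (pos \o f), (fun x y => col (f x) (f y)).
split; first exact: inj_comp pi (bij_inj f_bij).
by split=> *; [apply: cs | apply: h].
Qed.

End Transport.

Section PartialMaps.
Variables (R : realType) (X J : finType) (D : J -> pred X) (M : J -> X -> X) (K : nat).
Variable r : X -> nat.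
Hypothesis r_inj : injective r.
Hypothesis mono : forall j x x', D j x -> D j x' -> r x < r x' -> r (M j x) < r (M j x').
Hypothesis expand : forall T : {set X},
  #|X| <= 4 * #|T| -> 4 * #|T| <= 3 * #|X| -> #|X| <= K * exits D M setT T.
Hypothesis X_ge2 : 2 <= #|X|.

Lemma monotone_maps_graph :
  exists (n : nat) (e : rel 'I_n) (A B : {set 'I_n}),
    [/\ #|X| <= n, simple_graph e, max_degree e 3,
      bip_expander ((loss #|J|.*2.+2 K)%:R^-1 : R)%R e A B & has_queue_layout 2 e].
Proof.
have [V [V34 hV]] := prune expand.
(* The map [j] gets the index [(rk j).+1]; with [2 * #|J| + 3] indices all matchings stay off the
   folds. *)
pose Y : finType := {x : X | x \in V}; pose m' := #|J|.*2.+2.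
have cY : #|Y| = #|V| by rewrite card_sig; apply: eq_card => x; rewrite inE.
have [rk [rk_inj rk_lt]] : exists rk : J -> nat, injective rk /\ forall j, rk j < #|J|.
  exists (fun j => nat_of_ord (enum_rank j)); split=> [j k /val_inj/enum_rank_inj //|j]; exact: ltn_ord.
pose E (i : 'I_m'.+1) : rel Y := fun x y =>
  [exists j : J, (i == (rk j).+1 :> nat) && D j (val x) && (M j (val x) == val y)].
pose ry (y : Y) := r (val y); pose B := (\max_y ry y).+1.
have ry_inj : injective ry by move=> x y /r_inj/val_inj.
have ry_lt y : ry y < B by rewrite ltnS; apply: (leq_bigmax (F := ry)).
have E_range i x y : E i x y -> 0 < i /\ i.*2.+2 < m'.+1.
  move=> /existsP[j /andP[/andP[/eqP-> _] _]]; split=> //.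
  by have := rk_lt j; rewrite /m'; lia.
have EP i x y x' y' : E i x y -> E i x' y' -> exists j,
    [/\ D j (val x), D j (val x'), M j (val x) = val y & M j (val x') = val y'].
  move=> /existsP[j /andP[/andP[/eqP ij dx] /eqP mx]].
  move=> /existsP[k /andP[/andP[/eqP ik dx'] /eqP mx']]; exists j.
  suff jk : j = k by subst k.
  by apply: rk_inj; apply: succn_inj; rewrite -ij.
have E_fun i x y y' : E i x y -> E i x y' -> y = y'.
  by move=> h h'; have [j [_ _ h1 h2]] := EP _ _ _ _ _ h h'; apply: val_inj; apply: etrans (esym h1) h2.
have E_mono i x y x' y' : E i x y -> E i x' y' -> ry x < ry x' -> ry y < ry y'.
  by move=> h h'; have [j [d d' m1 m2]] := EP _ _ _ _ _ h h' => /(mono d d'); rewrite m1 m2.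
have E_inj' := E_inj ry_inj E_mono.
have expandY (T : {set Y}) : 3 * #|T| <= 2 * #|Y| ->
    #|T| <= K * \sum_i #|[set x in T | [exists y, E i x y && (y \notin T)]]|.
  move=> T23; have cT : #|val @: T| = #|T| by rewrite card_imset //; apply: val_inj.
  rewrite -cT; apply: leq_trans (hV _ _ _) _; last 2 first.
  - by rewrite cT -cY.
  - rewrite leq_mul2l; apply/orP; right.
    have lt j : (rk j).+1 < m'.+1 by have := rk_lt j; rewrite /m'; lia.
    pose h j : 'I_m'.+1 := Ordinal (lt j).
    have h_inj : injective h.
      by move=> j k /(congr1 val) [] /rk_inj.
    rewrite [leqRHS](bigID (mem (h @: setT))) /=; apply: leq_trans (leq_addr _ _).
    rewrite [leqRHS]big_imset /=; last by move=> *; apply: h_inj.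
    under [leqRHS]eq_bigl do rewrite inE; apply: leq_sum => j _.
      rewrite -(card_imset _ val_inj); apply: subset_leq_card; apply/subsetP => x.
      rewrite !inE => /andP[/imsetP[y yT ->] /andP[dy /andP[myT myV]]].
      apply/imsetP; exists y => //; rewrite inE yT; apply/existsP; exists (exist (fun x => x \in V) _ myV).
      apply/andP; split; first by apply/existsP; exists j; rewrite !eqxx dy.
      by apply: contra myT => hT; apply/imsetP; exists (exist (fun x => x \in V) _ myV).
  - by apply/subsetP => x /imsetP[y _ ->]; apply: valP.
pose G := adj E; pose W := vertex Y m'.
have /card_gt0P[x0 _] : 0 < #|Y| by rewrite cY; lia.
(* A single point has to expand, which yields an edge off the diagonal and thus a vertex of degree
   exactly 3. *)
have [i [x [y [exy xy]]]] : exists i x y, E i x y /\ x != y.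
  have := @expandY [set x0]; rewrite cards1 => /(_ ltac:(lia)).
  rewrite muln_gt0 => /andP[_]; rewrite lt0n sum_nat_eq0 negb_forall => /existsP[j].
  rewrite /= -lt0n => /card_gt0P[x]; rewrite !inE => /andP[/eqP-> /existsP[y]].
  by rewrite inE => /andP[e ne]; exists j, x0, y; rewrite eq_sym.
exists #|{: W}|, (fun v w => G (enum_val v) (enum_val w)),
  (enum_val @^-1: side Y m' false), (enum_val @^-1: side Y m' true).
have fK := @enum_valK W; have gK := @enum_rankK W.
split.
- by rewrite !card_prod card_bool card_ord cY; nia.
- exact: simple_preim (adj_simple E).
- exact: (max_degree_preim fK gK) (adj_max_degree ry_inj E_range E_fun E_mono exy xy).
- exact: (bip_expander_preim fK gK) (adj_expander R E_inj' expandY).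
- apply: (queue_preim fK gK); exists (pos ry B), (@col Y m').
  exact: adj_queue.
Qed.

End PartialMaps.

(** * The pieces as partial maps and the choice of constants *)

Section Assembly.
Variables (R : rcfType) (C i0 n : nat).
Hypotheses (i0_ge : 16 <= i0) (i0_C : 2048 * C <= 2 ^ i0) (i0_lt : i0 < n).
Local Notation X := (core n * digits n.*2 (max_digit i0))%type.
Hypothesis gap : forall T : {set X},
  #|T| * (#|{: X}| - #|T|) <= C * #|{: X}| * \sum_m #|[set x in T | tower_map m x \notin T]|.

Let i0_ge3 : 3 <= i0. Proof. exact: leq_trans i0_ge. Qed.

(** The number of partial maps depends on [i0] only, so the number of layers and the expansion
    constant are the same for all [n]. *)
Definition piece_index := ((bool * bool + (bool + bool)) * ('I_(2 ^ i0.*2) * bool))%type.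
Definition piece_dom (j : piece_index) : pred X := piece (j.2.1 : nat, j.2.2).
Definition piece_map (j : piece_index) : X -> X := tower_map j.1.

Lemma base_lt (x : X) : base x < 2 ^ i0.*2.
Proof.
rewrite /base; suff : forall k, k <= i0.*2 -> rank x k < 2 ^ k by apply.
elim=> [//|k IH] ki /=; have := digit_lt i0_ge3 i0_lt x k.
by rewrite /radix /digit_exp ki expn0 expnS => ?; have := IH (ltnW ki); lia.
Qed.

Lemma exits_good m (T : {set X}) :
  #|[set x in T | good x && (tower_map m x \notin T)]| <=
  \sum_c #|[set x in T | piece_dom (m, c) x && (piece_map (m, c) x \in setT :\: T)]|.
Proof.
under [leqRHS]eq_bigr do rewrite -sum1_card big_mkcond.
rewrite -sum1_card [leqLHS]big_mkcond exchange_big; apply: leq_sum => x _.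
rewrite inE; case: ifP => // /and3P[xT gx xM].
rewrite (bigD1 (Ordinal (base_lt x), overflow false x i0.*2)) //= !inE xT /=.
by rewrite /piece_dom /piece /= gx !eqxx /piece_map /= xM.
Qed.

Lemma tower_expand (T : {set X}) :
  #|{: X}| <= 4 * #|T| -> 4 * #|T| <= 3 * #|{: X}| ->
  #|{: X}| <= (8 * C) * exits piece_dom piece_map setT T.
Proof.
move=> T1 T3; have hgap := gap T; have hbad := card_bad R i0_ge3 i0_lt.
set bad := #|[set x | ~~ good x]| in hbad.
have leak : \sum_m #|[set x in T | tower_map m x \notin T]| <=
    8 * bad + exits piece_dom piece_map setT T.
  have -> : exits piece_dom piece_map setT T = \sum_m \sum_c
     #|[set x in T | piece_dom (m, c) x && (piece_map (m, c) x \in setT :\: T)]|.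
    by rewrite pair_bigA; apply: eq_bigr => -[].
  have -> : 8 * bad = \sum_(m : bool * bool + (bool + bool)) bad.
    by rewrite sum_nat_const card_sum card_prod card_sum card_bool.
  rewrite -big_split; apply: leq_sum => m _ /=.
  apply: leq_trans (leq_add (leqnn _) (exits_good m T)).
  apply: leq_trans (leq_card_setU _ _).1; apply: subset_leq_card; apply/subsetP => x.
  by rewrite !inE => /andP[-> ->]; case: (good x).
have sq : 3 * #|{: X}| * #|{: X}| <= 16 * (#|T| * (#|{: X}| - #|T|)).
  by move: T1 T3; move: #|T| #|{: X}| => t X1 h1 h3; nia.
have X0 : 0 < #|{: X}| by apply/card_gt0P; exists 0%R.
have h3 : 3 * #|{: X}| <= 16 * (C * (8 * bad + exits piece_dom piece_map setT T)).
  rewrite -(leq_pmul2r X0); apply: leq_trans sq _; rewrite -mulnA leq_mul2l /=.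
  apply: leq_trans hgap _; rewrite mulnAC leq_mul2r leq_mul2l leak; lia.
have hb : 2048 * C * bad <= 16 * #|{: X}|.
  by apply: leq_trans hbad; rewrite leq_mul2r i0_C orbT.
(* The bad points contribute [128 * C * bad], at most a third of the left side [3 * #|X|]; this
   explains [2048 = 16 * 128]. *)
move: h3 hb; clear; move: #|{: X}| bad (exits _ _ _ _) => a b c; nia.
Qed.

End Assembly.

Theorem theorem4 (R : realType) :
  exists eps : R, (0 < eps)%R /\ (eps <= 1)%R /\
    forall N : nat, exists (n : nat) (e : rel 'I_n) (A B : {set 'I_n}),
      (N <= n)%N /\ simple_graph e /\ max_degree e 3 /\
      bip_expander eps e A B /\ has_queue_layout 2 e.
Proof.
(* [i0] is fixed in terms of the gap constant; only [n] grows with [N]. *)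
have [C gap] := tower_gap R; pose i0 := 2048 * C + 16.
have i0_ge : 16 <= i0 by rewrite leq_addl.
have i0_C : 2048 * C <= 2 ^ i0.
  by apply: leq_trans (ltnW (ltn_expl _ (ltnSn 1))); rewrite leq_addr.
have i0_ge3 : 3 <= i0 by apply: leq_trans i0_ge.
exists ((loss #|{: piece_index i0}|.*2.+2 (8 * C))%:R^-1)%R.
have l1 : 1 <= loss #|{: piece_index i0}|.*2.+2 (8 * C) by rewrite /loss muln_gt0.
split; first by rewrite invr_gt0 ltr0n.
split; first by rewrite invf_le1 ?ltr0n // ler1n.
move=> N; pose n := N + i0.+1; have i0_lt : i0 < n by rewrite /n; lia.
pose X := (core n * digits n.*2 (max_digit i0))%type.
have XN : N + 2 <= #|{: X}|.
  rewrite (card_prod (core n)) card_core; have := card_digits_gt0 n.*2 (max_digit i0).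
  move=> d0; apply: leq_trans (leq_pmulr _ d0); apply: leq_trans (leq_pmulr _ _); last first.
    by rewrite expn_gt0.
  by apply: leq_trans (ltnW (ltn_expl _ (ltnSn 1))); rewrite /n; lia.
have mono (j : piece_index i0) (x x' : X) : piece_dom j x -> piece_dom j x' ->
    rank x n.*2 < rank x' n.*2 -> rank (piece_map j x) n.*2 < rank (piece_map j x') n.*2.
  by move=> dx dx'; apply: (tower_rank_mono i0_ge3 i0_lt _ dx dx').2.
have expand := tower_expand R i0_ge i0_C i0_lt (gap i0 n i0_ge i0_lt).
have [|k [e [A [B [Nk e1 e2 e3 e4]]]]] :=
  monotone_maps_graph R (rank_inj i0_ge3 i0_lt) mono expand;
  first by apply: leq_trans XN; rewrite leq_addl.
exists k, e, A, B; split=> //.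
by apply: leq_trans Nk; apply: leq_trans XN; rewrite leq_addr.
Qed.
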